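(* Let $(T_n)_{n\ge 1}$ be a uniform random recursive tree and let $I_n$ be the index of the betweenness center of $T_n$. Then $I_n$ is persistent: there exist integer-valued random variables $N,K$ with $\mathbb{P}(N<\infty)=\mathbb{P}(K<\infty)=1$ such that $I_n=K$ for all $n\ge N$.
   Context: A uniform random recursive tree (URRT) is a random sequence of trees $(T_n)_{n\ge 1}$ with $V(T_n)=[n]=\{1,\ldots,n\}$: $T_1$ is the single vertex $1$ (the root), and $T_{n+1}$ is obtained from $T_n$ by adding vertex $n+1$ and an edge $\{i,n+1\}$, where $i$ is chosen uniformly at random from $[n]$, independently of the past. The betweenness centrality of $v\in V(T_n)$ is $\mathcal{B}_{T_n}(v)=\sum_{s,t\in V(T_n):\,s,t\ne v}\mathbf{1}_{\{v\in\sigma_{s,t}\}}$, where $\sigma_{s,t}$ is the path between $s$ and $t$ in $T_n$ excluding $s$ and $t$; larger values correspond to more central vertices. Ranking: vertices are ordered from most to least central; vertices with equal centrality value are ordered in reverse order of insertion time (if $u,v$ have equal centrality, $u$ is ranked before $v$ iff $u>v$). This gives a permutation $\gamma_n$ of $[n]$, where $\gamma_n(v)\in\{1,\ldots,n\}$ is the position of $v$ in this order (position $1$ being most central). The center is the vertex $v\in[n]$ with $\gamma_n(v)=1$, and its index $I_n$ is the integer $v$. *)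

(* Defs.v *)
From HB Require Import structures.
From mathcomp Require Import all_boot all_order all_algebra.
From mathcomp Require Import all_classical all_reals all_analysis.

Set Implicit Arguments.
Unset Strict Implicit.
Unset Printing Implicit Defensive.

Import Order.TTheory GRing.Theory Num.Theory.

Local Open Scope classical_set_scope.
Local Open Scope ring_scope.

(* A graph on the vertex set [n] = {1, ..., n} is given by n and its adjacency
   relation on nat; [iota 1 n] lists the vertices. *)

Definition no_edge : rel nat := fun _ _ => false.

Definition add_edge (e : rel nat) (i j : nat) : rel nat :=
  fun u v => [|| e u v, (u == i) && (v == j) | (u == j) && (v == i)].

Definition simple_path (e : rel nat) (s t : nat) : set (seq nat) :=
  [set p | [/\ path e s p, last s p = t & uniq (s :: p)]].

(* In a tree on [n], [simple_path e s t] has exactly one element when s and t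
   are vertices, so [xget] selects the path between s and t. *)
Definition inner_path (e : rel nat) (s t : nat) : seq nat :=
  [seq u <- s :: xget [::] (simple_path e s t) | (u != s) && (u != t)].

Definition betweenness (e : rel nat) (n v : nat) : nat :=
  (\sum_(s <- iota 1 n | s != v) \sum_(t <- iota 1 n | t != v)
     (v \in inner_path e s t))%N.

Definition rank_le (e : rel nat) (n : nat) : rel nat := fun u v =>
  ((betweenness e n v < betweenness e n u) ||
   ((betweenness e n u == betweenness e n v) && (v <= u)))%N.

Definition rank_pos (e : rel nat) (n v : nat) : nat :=
  (index v (sort (rank_le e n) (iota 1 n))).+1.

(* The default value 0 is only reached for n = 0. *)
Definition center_index (e : rel nat) (n : nat) : nat :=
  head 0%N [seq v <- iota 1 n | rank_pos e n v == 1%N].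

Section URRT.
Context {R : realType} {d : measure_display} {Omega : measurableType d}.

(* [c n] is the vertex of [n] to which n + 1 is attached; [T 0] plays no role.
   All variables are discrete, so independence of [c n] from the past
   (T_1, ..., T_n) is the product rule on the events fixing their values. *)
Definition is_URRT (P : probability Omega R) (T : nat -> Omega -> rel nat) :=
  (forall w, T 1%N w = no_edge) /\
  exists c : nat -> Omega -> nat, forall n : nat, (1 <= n)%N ->
    [/\ forall w, (1 <= c n w <= n)%N,
        forall i, measurable [set w | c n w = i],
        forall w, T n.+1 w = add_edge (T n w) (c n w) n.+1,
        forall i, (1 <= i <= n)%N ->
          P [set w | c n w = i] = (n%:R^-1)%:E
      & forall (i : nat) (t : nat -> rel nat),
          let past := [set w | forall k, (1 <= k <= n)%N -> T k w = t k] in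
          P ([set w | c n w = i] `&` past)
          = (P [set w | c n w = i] * P past)%E].

(* A random variable with values in the integers and +oo, -oo; the codomain
   being countable, measurability is tested on singletons. *)
Definition is_integer_rv (X : Omega -> \bar int) : Prop :=
  forall x : \bar int, measurable (X @^-1` [set x]).

End URRT.

(* Main.v *)
(* Let D_n be the difference of the betweenness centralities of two fixed
   vertices u, v of T_n.  The drift of the centrality in one step depends on the
   vertex only through the centrality itself, so D_n / (n (n+1)) is an exact
   martingale, with increments O(1/n); by a maximal inequality it moves by less
   than any fixed amount after a large time N, with high probability.  It is not
   close to 0 at time N either: once u has two children w, w' younger than u and
   v, then, given everything except how the later vertices below w and w' are
   shared between the two subtrees, D_N equals Q + 2 j (s - j), where s is the
   total size of the two subtrees and j the size of the first one, and j has no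
   atom larger than a constant over s (Polya urn).  Hence the order of u and v is
   eventually constant.  Finally the center always has a subtree of size at least
   n / 8, while the second moment of the subtree size shows that with high
   probability no vertex of large index ever has one, so that only finitely many
   vertices compete.  All of this is a statement about finite averages, uniform in
   the horizon. *)

Require Import Defs.
From mathcomp Require Import all_boot all_order all_algebra.
From mathcomp Require Import all_classical all_reals all_analysis.
From mathcomp Require Import zify ring lra.

Set Implicit Arguments.
Unset Strict Implicit.
Unset Printing Implicit Defensive.

Import Order.TTheory GRing.Theory Num.Theory.

(** * Attachment sequences and the components of the tree minus a vertex *)

Local Open Scope nat_scope.

(* An attachment sequence: [c k] is the parent of [k.+1], and [c 0] is a dummy
   forced to be 0. *)
Definition valid (c : nat -> nat) := forall k, (0 < k) <= c k <= k.

Fixpoint tree (c : nat -> nat) (n : nat) : rel nat :=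
  if n is m.+1 then if m is 0 then no_edge else add_edge (tree c m) (c m) m.+1
  else no_edge.

(* Component of [x] in the tree minus [v]: the child of [v] above [x], or 0 if
   [x] is not a proper descendant of [v]; the fuel [x] is enough because
   [c x.-1 < x]. *)
Fixpoint comp_rec (c : nat -> nat) (v f x : nat) : nat :=
  if f is f'.+1 then
    if x <= v then 0 else if c x.-1 == v then x else comp_rec c v f' (c x.-1)
  else 0.

Definition comp c v x := comp_rec c v x x.

(** Fixing [c k] for [k < m] fixes the parents of the vertices up to [m], that is, the tree on
    [m]. *)
Definition agree m (c c' : nat -> nat) := forall k, k < m -> c k = c' k.

(** Betweenness free of paths: [v] lies inside the path from [s] to [t] exactly when [s] and [t] are
    in different components of the tree minus [v]; label 0 is the component above [v]. *)
Definition btw c n v : nat :=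
  \sum_(1 <= s < n.+1 | s != v) \sum_(1 <= t < n.+1 | t != v)
    (comp c v s != comp c v t).

Definition subtree_size c n v : nat :=
  \sum_(1 <= x < n.+1) ((x == v) || (comp c v x != 0)).

Lemma valid_lt c x : valid c -> 0 < x -> c x.-1 < x.
Proof. by move=> vc; case: x => //= x _; rewrite ltnS; case/andP: (vc x). Qed.

(** Parents are smaller than children, so every fuel at least [x] gives the same value. *)
Lemma compE c v x : valid c ->
  comp c v x = if x <= v then 0 else if c x.-1 == v then x else comp c v (c x.-1).
Proof.
move=> vc; have fuel : forall f g y, y <= f -> y <= g ->
    comp_rec c v f y = comp_rec c v g y.
  elim=> [|f IH] [|g] y //= yf yg.
  - by move: yf; rewrite leqn0 => /eqP ->.
  - by move: yg; rewrite leqn0 => /eqP ->.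
  - case: leqP => // vy; case: eqP => // _.
    have lt := valid_lt vc (leq_ltn_trans (leq0n v) vy).
    by apply: IH; rewrite -ltnS; apply: leq_trans lt _.
rewrite {1}/comp; case: x => [|x] /=; first by [].
case: leqP => // vx; case: eqP => // _.
by apply: fuel => //; rewrite -ltnS; apply: (valid_lt (x := x.+1)).
Qed.

Lemma comp_le c v x : valid c -> x <= v -> comp c v x = 0.
Proof. by move=> vc h; rewrite compE // h. Qed.

Lemma comp_child c v x : valid c -> v < x -> c x.-1 = v -> comp c v x = x.
Proof. by move=> vc h e; rewrite compE // leqNgt h e eqxx. Qed.

Lemma comp_parent c v x : valid c -> v < x -> c x.-1 != v ->
  comp c v x = comp c v (c x.-1).
Proof. by move=> vc h e; rewrite compE // leqNgt h (negbTE e). Qed.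

Lemma comp_agree c c' v x : valid c -> valid c' -> agree x c c' ->
  comp c v x = comp c' v x.
Proof.
move=> vc vc'; have [n] := ubnP x; elim: n x => // n IH x xn ag.
rewrite (compE v x vc) (compE v x vc'); case: leqP => // vx.
have x0 : 0 < x by apply: leq_ltn_trans vx.
rewrite -ag ?prednK //; case: eqP => // _.
have lt := valid_lt vc x0.
apply: IH; first by apply: leq_trans lt _; rewrite -ltnS.
by move=> k kl; apply: ag; apply: ltn_trans lt.
Qed.

Lemma comp_bound c v x : valid c -> comp c v x <= x.
Proof.
move=> vc; have [n] := ubnP x; elim: n x => // n IH x xn.
rewrite compE //; case: (leqP x v) => // vx; case: (eqVneq (c x.-1) v) => // _.
have lt := valid_lt vc (leq_ltn_trans (leq0n v) vx).
by apply: leq_trans (ltnW lt); apply: IH; apply: leq_trans lt _; rewrite -ltnS.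
Qed.

(** Lets a component of the tree minus [v] be bounded by the subtree of its top vertex, in
    [exists_centroid]. *)
Lemma comp_desc c v x y : valid c -> comp c v x = y -> y != 0 ->
  v < y /\ ((x == y) || (comp c y x != 0)).
Proof.
move=> vc; have [n] := ubnP x; elim: n x => // n IH x xn.
rewrite compE //; case: (leqP x v) => [_ <- //|vx].
have lt := valid_lt vc (leq_ltn_trans (leq0n v) vx).
case: eqP => [e <- _|_ h y0]; first by rewrite vx eqxx.
have [vy] := IH _ (leq_trans lt xn) h y0.
have yx : y < x by apply: leq_ltn_trans lt; rewrite -h comp_bound.
move=> d; split=> //; apply/orP; right.
rewrite compE // leqNgt yx /=; case: (eqVneq (c x.-1) y) d => //= _ _.
by rewrite -lt0n (leq_ltn_trans _ yx).
Qed.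

(** * Paths in the tree and betweenness *)

Lemma treeE c n x y : valid c ->
  tree c n x y = [&& 1 < y <= n & c y.-1 == x] || [&& 1 < x <= n & c x.-1 == y].
Proof.
move=> vc; elim: n => [|[|n] IH] /=.
- by rewrite /no_edge !leqn0; lia.
- by rewrite /no_edge; lia.
- move: IH => /=; rewrite /add_edge => ->.
  case: (eqVneq y n.+2) => [->|ny]; case: (eqVneq x n.+2) => [->|nx] /=; lia.
Qed.

Lemma tree_sym c n : valid c -> symmetric (tree c n).
Proof. by move=> vc x y; rewrite !treeE // orbC. Qed.

Lemma tree_comp c n v x y : valid c -> tree c n x y -> x != v -> y != v ->
  comp c v x = comp c v y.
Proof.
move=> vc; wlog: x y / [&& 1 < y <= n & c y.-1 == x].
  move=> H; rewrite treeE // => /orP[] h xv yv.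
  - by apply: H => //; rewrite treeE // h.
  - by apply/esym/H => //; rewrite treeE // h.
move=> /andP[/andP[y1 _] /eqP e] _ xv yv.
have := valid_lt vc (ltnW y1); rewrite e => xy.
case: (leqP y v) => yv'; first by rewrite !comp_le //; lia.
by rewrite [in RHS]comp_parent // e.
Qed.

Lemma path_comp c n v s p : valid c -> path (tree c n) s p -> v \notin s :: p ->
  comp c v s = comp c v (last s p).
Proof.
move=> vc; elim: p s => //= y p IH s /andP[e hp].
rewrite !inE !negb_or => /and3P[sv yv vp].
rewrite -IH ?inE ?negb_or ?yv //.
by apply: tree_comp e _ _ => //; rewrite eq_sym.
Qed.

Lemma nbr_comp c n v a b : valid c -> tree c n a v -> tree c n v b -> a != b ->
  comp c v a != comp c v b.
Proof.
move=> vc ea eb ab.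
have nb x : tree c n v x -> x = c v.-1 /\ comp c v x = 0 \/ comp c v x = x /\ 0 < x.
  rewrite treeE // => /orP[/andP[/andP[x1 xn] /eqP e]|/andP[/andP[v1 vn] /eqP e]].
    by right; rewrite comp_child // -?e ?valid_lt //; lia.
  by left; rewrite comp_le // -e ltnW // valid_lt //; lia.
have ea' : tree c n v a by rewrite tree_sym.
by case: (nb _ ea') (nb _ eb) => -[h1 h2] [] [h3 h4]; lia.
Qed.

(** A path that avoids [v] stays in one component. A simple path through [v] enters and leaves by
    two distinct neighbours, which lie in different components by [nbr_comp]. *)
Lemma simple_path_sep c n v s t p : valid c -> simple_path (tree c n) s t p ->
  s != v -> t != v -> (v \in s :: p) = (comp c v s != comp c v t).
Proof.
move=> vc [hp ht hu] sv tv.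
case: (boolP (v \in s :: p)) => vp; last by rewrite -ht -(path_comp vc hp) ?eqxx.
symmetry; move: vp; rewrite inE eq_sym (negbTE sv) /= => vp.
case/splitPr: vp hp ht hu => p1 p2; rewrite cat_path last_cat /=.
case: p2 => [_ /eqP|b p2 /=]; first by rewrite eq_sym (negbTE tv).
move=> /and4P[hp1 ea eb hp2] ht.
rewrite mem_cat cat_uniq /= !inE !negb_or -!andbA.
move=> /and5P[_ _ sb _ /and5P[_ v1 b1 _ /and4P[vb vp2 _ _]]].
have -> : comp c v s = comp c v (last s p1).
  by apply: path_comp hp1 _ => //; rewrite inE negb_or eq_sym sv.
rewrite -ht -(path_comp vc hp2) ?inE ?negb_or ?vb //.
apply: nbr_comp ea eb _ => //; apply/eqP => e.
case: p1 e b1 {hp1 v1} => [/= e|z p1 /= e]; first by rewrite e eqxx in sb.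
by rewrite -e mem_last.
Qed.

(** Both vertices climb to the root; one climb followed by the reverse of the other is a walk, which
    [shortenP] makes simple. *)
Lemma tree_connected c n s t : valid c -> 0 < s <= n -> 0 < t <= n ->
  exists p, simple_path (tree c n) s t p.
Proof.
move=> vc hs ht.
have root x : 0 < x <= n -> exists p, path (tree c n) x p /\ last x p = 1.
  have [m] := ubnP x; elim: m x => // m IH x xm hx.
  case: (eqVneq x 1) => [->|x1]; first by exists [::].
  have x0 : 0 < x by case/andP: hx.
  have lt := valid_lt vc x0.
  have c0 : 0 < c x.-1.
    by have /andP[+ _] := vc x.-1; have -> : 0 < x.-1 by lia.
  have [|] := IH (c x.-1) (leq_trans lt xm); first by lia.
  move=> p [hp lp]; exists (c x.-1 :: p); split=> //=.
  by rewrite hp treeE // eqxx; lia.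
have [p [hp lp]] := root _ hs; have [q [hq lq]] := root _ ht.
have [r [hr lr]] : exists r, path (tree c n) s r /\ last s r = t.
  exists (p ++ rev (belast t q)); rewrite cat_path last_cat hp lp -lq rev_path.
  split; first by rewrite (eq_path (e' := tree c n)) // => a b; exact: tree_sym.
  by case: (q) => [|y q'] //=; rewrite rev_cons last_rcons.
by case/shortenP: hr lr => p' hp' up' _ lr; exists p'.
Qed.

Lemma inner_path_sep c n v s t : valid c -> 0 < s <= n -> 0 < t <= n ->
  s != v -> t != v -> (v \in inner_path (tree c n) s t) = (comp c v s != comp c v t).
Proof.
move=> vc hs ht sv tv; rewrite /inner_path mem_filter !(eq_sym v) sv tv /=.
(* [xget] returns some simple path once one exists, and [simple_path_sep] applies to every simple
   path. *)
apply: simple_path_sep => //; have [p hp] := tree_connected vc hs ht.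
exact: (xgetPex [::] (ex_intro _ p hp)).
Qed.

Lemma betweennessE c n v : valid c -> betweenness (tree c n) n v = btw c n v.
Proof.
move=> vc; rewrite /betweenness /btw /index_iota subSS subn0.
rewrite big_seq_cond [RHS]big_seq_cond; apply: eq_bigr => s.
rewrite mem_iota => /andP[hs sv].
rewrite big_seq_cond [RHS]big_seq_cond; apply: eq_bigr => t.
rewrite mem_iota => /andP[ht tv].
by rewrite inner_path_sep //; lia.
Qed.

(** * Averages over attachment sequences *)

Definition upd (c : nat -> nat) n i : nat -> nat := fun k => if k == n then i else c k.

Lemma upd_valid c n i : valid c -> 0 < i <= n -> valid (upd c n i).
Proof. by move=> vc hi k; rewrite /upd; case: eqP => [->|_]; [lia|exact: vc]. Qed.

Lemma upd_agree c n i : agree n c (upd c n i).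
Proof. by move=> k kn; rewrite /upd ltn_eqF. Qed.

Lemma agree_le m n c c' : m <= n -> agree n c c' -> agree m c c'.
Proof. by move=> mn h k km; apply: h; apply: leq_trans km mn. Qed.

Lemma agree_trans m c c' c'' : agree m c c' -> agree m c' c'' -> agree m c c''.
Proof. by move=> h h' k km; rewrite h // h'. Qed.

Lemma agree_sym m c c' : agree m c c' -> agree m c' c.
Proof. by move=> h k km; rewrite h. Qed.

Definition adapted (A : Type) n (f : (nat -> nat) -> A) :=
  forall c c', valid c -> valid c' -> agree n c c' -> f c = f c'.

Section Expectation.
Context {R : realFieldType}.
Local Open Scope ring_scope.
Implicit Types (f g : (nat -> nat) -> R) (c : nat -> nat).

(** Vertex [n.+1] is attached to a uniform vertex of [n]; on functions adapted to [n.+1] this is the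
    conditional expectation given the tree on [n]. *)
Definition avg n f c : R := n%:R^-1 * \sum_(1 <= i < n.+1) f (upd c n i).

(* The conditional expectation of [f] given the first [m] vertices, provided
   [f] only depends on the first [n]. *)
Fixpoint Ex m n f : (nat -> nat) -> R :=
  if n is n'.+1 then if (m <= n')%N then Ex m n' (avg n' f) else f else f.

Lemma ExS m n f c : (m <= n)%N -> Ex m n.+1 f c = Ex m n (avg n f) c.
Proof. by move=> /= ->. Qed.

Lemma Exnn m f c : Ex m m f c = f c.
Proof. by case: m => //= m; rewrite ltnn. Qed.

Lemma Ex_ind (Q : nat -> Prop) m : Q m -> (forall n, (m <= n)%N -> Q n -> Q n.+1) ->
  forall n, (m <= n)%N -> Q n.
Proof.
move=> q0 qS n mn; rewrite -(subnKC mn); elim: (n - m)%N => [|k IH].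
  by rewrite addn0.
by rewrite addnS; apply: qS => //; exact: leq_addr.
Qed.

Lemma avg_le n f g c : (forall i, (0 < i <= n)%N -> f (upd c n i) <= g (upd c n i)) ->
  avg n f c <= avg n g c.
Proof.
move=> h; rewrite /avg ler_wpM2l ?invr_ge0 ?ler0n //.
by rewrite big_nat [X in _ <= X]big_nat; apply: ler_sum => i; rewrite ltnS => /h.
Qed.

Lemma avg_cst n (a : R) c : (0 < n)%N -> avg n (fun=> a) c = a.
Proof.
move=> n0; rewrite /avg sumr_const_nat subSS subn0 -[a *+ n]mulr_natl mulrA.
by rewrite mulVf ?mul1r // pnatr_eq0 -lt0n.
Qed.

Lemma Ex_le m n f g c : (0 < m <= n)%N -> valid c ->
  (forall c', valid c' -> agree m c c' -> f c' <= g c') -> Ex m n f c <= Ex m n g c.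
Proof.
move=> /andP[m0 mn] vc; elim/Ex_ind: n / mn f g => [f g h|n mn IH f g h].
  by rewrite !Exnn; apply: h.
rewrite !ExS //; apply: IH => c' vc' ag; apply: avg_le => i hi; apply: h.
  exact: upd_valid.
exact: agree_trans ag (agree_le mn (@upd_agree _ _ _)).
Qed.

Lemma Ex_eq m n f g c : (0 < m <= n)%N -> valid c ->
  (forall c', valid c' -> agree m c c' -> f c' = g c') -> Ex m n f c = Ex m n g c.
Proof.
by move=> mn vc h; apply/eqP; rewrite eq_le; apply/andP; split; apply: Ex_le => // c' v a;
  rewrite h.
Qed.

Lemma Ex_cst m n (a : R) c : (0 < m <= n)%N -> Ex m n (fun=> a) c = a.
Proof.
move=> /andP[m0 mn]; elim/Ex_ind: n / mn c => [c|n mn IH c]; first by rewrite Exnn.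
rewrite ExS // -[RHS](IH c); congr (Ex m n _ c); apply/funext => c'.
by rewrite avg_cst //; apply: leq_trans mn.
Qed.

Lemma ExD m n f g c : (m <= n)%N -> Ex m n (fun c => f c + g c) c = Ex m n f c + Ex m n g c.
Proof.
move=> mn; elim/Ex_ind: n / mn f g => [f g|n mn IH f g]; first by rewrite !Exnn.
rewrite !ExS // -IH; congr (Ex m n _ c); apply/funext => c'.
by rewrite /avg big_split mulrDr.
Qed.

Lemma ExZ m n a f c : (m <= n)%N -> Ex m n (fun c => a * f c) c = a * Ex m n f c.
Proof.
move=> mn; elim/Ex_ind: n / mn f => [f|n mn IH f]; first by rewrite !Exnn.
rewrite !ExS // -IH; congr (Ex m n _ c); apply/funext => c'.
by rewrite /avg -mulr_sumr mulrCA.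
Qed.

Lemma Ex_sum (I : Type) (r : seq I) (Q : pred I) m n (F : I -> (nat -> nat) -> R) c :
  (0 < m <= n)%N ->
  Ex m n (fun c => \sum_(i <- r | Q i) F i c) c = \sum_(i <- r | Q i) Ex m n (F i) c.
Proof.
move=> mn; elim: r => [|i r IH].
  rewrite big_nil -[RHS](Ex_cst _ c mn); congr (Ex m n _ c).
  by apply/funext => c'; rewrite big_nil.
rewrite big_cons -IH; case: ifP => Qi; rewrite -?ExD ?(andP mn).2 //;
  by congr (Ex m n _ c); apply/funext => c'; rewrite big_cons Qi.
Qed.

Lemma Ex_tower m n p f c : (m <= n <= p)%N -> Ex m p f c = Ex m n (Ex n p f) c.
Proof.
move=> /andP[mn np]; elim/Ex_ind: p / np f => [f|p np IH f].
  by congr (Ex m n _ c); apply/funext => c'; rewrite Exnn.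
rewrite ExS ?(leq_trans mn) // IH; congr (Ex m n _ c); apply/funext => c'.
by rewrite ExS.
Qed.

Lemma Ex_supermartingale (W : nat -> (nat -> nat) -> R) m n c :
  (0 < m <= n)%N -> valid c ->
  (forall k c', (m <= k)%N -> valid c' -> agree m c c' ->
     avg k (W k.+1) c' <= W k c') ->
  Ex m n (W n) c <= W m c.
Proof.
move=> /andP[m0 mn] vc h; elim/Ex_ind: n / mn => [|n mn IH]; first by rewrite Exnn.
rewrite ExS //; apply: le_trans IH; apply: Ex_le => [|//|c' vc' ag].
  by rewrite m0.
exact: h.
Qed.

(** Ville's inequality. The stopped process [V], equal to 1 once level [a] has been reached and to
    [W / a] before, is a supermartingale that dominates the indicator of a hit. *)
Lemma maximal_inequality (W : nat -> (nat -> nat) -> R) (a : R) m n c :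
  (0 < m <= n)%N -> valid c -> 0 < a ->
  (forall k, (m <= k)%N -> adapted k (W k)) ->
  (forall k c', (m <= k)%N -> valid c' -> agree m c c' -> 0 <= W k c') ->
  (forall k c', (m <= k)%N -> valid c' -> agree m c c' ->
     avg k (W k.+1) c' <= W k c') ->
  Ex m n (fun c => (has (fun k => a <= W k c) (index_iota m n.+1))%:R) c <= W m c / a.
Proof.
move=> mn vc a0 ad W0 h.
pose hit k c' := has (fun j => a <= W j c') (index_iota m k.+1).
pose V k c' : R := if hit k c' then 1 else W k c' / a.
have hitS k c' : (m <= k)%N -> hit k.+1 c' = hit k c' || (a <= W k.+1 c').
  move=> mk; rewrite /hit /index_iota subSn ?(leq_trans mk) //.
  by rewrite -addn1 iotaD has_cat subnKC ?(leq_trans mk) //= orbF.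
have le_V k c' : (m <= k)%N -> valid c' -> agree m c c' -> (hit k c')%:R <= V k c'.
  by move=> mk vc' ag; rewrite /V; case: (hit k c') => //=; rewrite divr_ge0 ?W0 ?ltW.
have V_le k c' : a <= W k c' -> 1 <= W k c' / a by rewrite ler_pdivlMr // mul1r.
apply: le_trans (_ : V m c <= _); last first.
  rewrite /V /hit /index_iota subSnn /= orbF; case: ifP => // /V_le; exact.
apply: (le_trans (Ex_le mn vc (fun c' v ag => le_V n c' (andP mn).2 v ag))).
apply: Ex_supermartingale => // k c' mk vc' ag.
have k0 : (0 < k)%N by apply: leq_trans mk; case/andP: mn.
have hit_upd i : (0 < i <= k)%N -> hit k (upd c' k i) = hit k c'.
  move=> hi; apply: eq_in_has => j; rewrite mem_index_iota ltnS => /andP[mj jk].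
  congr (_ <= _); apply: ad => //; first exact: upd_valid.
  exact: agree_sym (agree_le jk (@upd_agree _ _ _)).
rewrite [leRHS]/V; case: ifP => hk.
  rewrite -[leRHS](avg_cst 1 c' k0); apply: avg_le => i hi.
  by rewrite /V hitS // hit_upd // hk.
(* Before any hit, [V k.+1] is at most [W k.+1 / a], whether or not the next step hits. *)
apply: le_trans (_ : avg k (W k.+1) c' / a <= _); last first.
  by rewrite ler_pM2r ?invr_gt0 // h.
rewrite /avg -mulrA mulr_suml; apply: (avg_le (g := fun c => W k.+1 c / a)) => i hi.
rewrite /V hitS // hit_upd // hk /=; case: ifP => // /V_le; exact.
Qed.

End Expectation.

(** * Martingales of the recursive tree *)

Lemma comp_adapted n v x : x <= n -> adapted n (fun c => comp c v x).
Proof. by move=> xn c c' vc vc' ag; apply: comp_agree => //; apply: agree_le ag. Qed.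

Lemma comp_upd c n i v x : valid c -> 0 < i <= n -> x <= n ->
  comp (upd c n i) v x = comp c v x.
Proof.
move=> vc hi xn.
exact: (comp_adapted v xn (upd_valid vc hi) vc (agree_sym (@upd_agree _ _ _))).
Qed.

Lemma comp_upd_new c n i v : valid c -> 0 < i <= n -> v <= n ->
  comp (upd c n i) v n.+1 = if i == v then n.+1 else comp c v i.
Proof.
move=> vc hi vn; rewrite compE; last exact: upd_valid.
rewrite leqNgt ltnS vn /= {1 3}/upd eqxx; case: eqP => // _.
by rewrite comp_upd //; case/andP: hi.
Qed.

Lemma btw_adapted n v : adapted n (fun c => btw c n v).
Proof.
move=> c c' vc vc' ag; rewrite /btw big_nat_cond [RHS]big_nat_cond.
apply: eq_bigr => s /andP[hs _].
rewrite big_nat_cond [RHS]big_nat_cond; apply: eq_bigr => t /andP[ht _].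
by rewrite !(comp_adapted _ _ vc vc' ag) //; lia.
Qed.

(** The new vertex can be the first or the second endpoint of a separated pair, hence the factor
    2. *)
Lemma btwS c n v : 0 < v <= n ->
  btw c n.+1 v = btw c n v +
    2 * \sum_(1 <= s < n.+1 | s != v) (comp c v s != comp c v n.+1).
Proof.
move=> hv; have nv : n.+1 != v by lia.
rewrite /btw big_mkcond big_nat_recr //= -big_mkcond /= nv.
rewrite [X in _ + X]big_mkcond big_nat_recr //= -big_mkcond /= nv eqxx addn0.
under eq_bigr => s _.
  rewrite big_mkcond big_nat_recr //= -big_mkcond /= nv; over.
rewrite big_split /= -addnA mulSn mul1n; congr (_ + (_ + _)).
by apply: eq_bigr => s _; rewrite eq_sym.
Qed.

Lemma sum_pred1 n v (F : nat -> nat) : 0 < v <= n ->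
  \sum_(1 <= i < n.+1) F i = F v + \sum_(1 <= i < n.+1 | i != v) F i.
Proof. by move=> hv; rewrite (bigD1_seq v) ?mem_index_iota ?iota_uniq. Qed.

Lemma sum_nat1 n : \sum_(1 <= t < n.+1) 1 = n.
Proof. by rewrite sum_nat_const_nat subSS subn0 muln1. Qed.

Lemma sum_neq1 n v : 0 < v <= n -> \sum_(1 <= t < n.+1 | t != v) 1 = n.-1.
Proof. by move=> hv; have := sum_pred1 (fun=> 1) hv; rewrite sum_nat1 add1n => {2}->. Qed.

(** Attached to [i != v], the new vertex joins the component of [i]; summing over these [i] the
    vertices it is separated from gives [btw c n v] again. Attached to [v], it opens a component and
    is separated from the other [n.-1] vertices. *)
Lemma sum_btw_upd c n v : valid c -> 0 < v <= n ->
  \sum_(1 <= i < n.+1) btw (upd c n i) n.+1 v = n.+2 * btw c n v + 2 * n.-1.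
Proof.
move=> vc hv.
pose F (y : nat) := \sum_(1 <= s < n.+1 | s != v) (comp c v s != y).
have -> : \sum_(1 <= i < n.+1) btw (upd c n i) n.+1 v =
   \sum_(1 <= i < n.+1) (btw c n v + 2 * F (if i == v then n.+1 else comp c v i)).
  rewrite big_nat [RHS]big_nat; apply: eq_bigr => i; rewrite ltnS => hi.
  rewrite btwS // (@btw_adapted _ _ _ c) //; first last.
  - exact: agree_sym (@upd_agree _ _ _).
  - exact: upd_valid.
  congr (_ + 2 * _); rewrite /F comp_upd_new //; last by case/andP: hv.
  rewrite big_nat_cond [RHS]big_nat_cond; apply: eq_bigr => s /andP[hs _].
  by rewrite comp_upd //; lia.
rewrite big_split /= sum_nat_const_nat subSS subn0 -big_distrr /= (sum_pred1 _ hv) eqxx.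
have -> : F n.+1 = n.-1.
  rewrite /F -(sum_neq1 hv).
  rewrite big_nat_cond [RHS]big_nat_cond; apply: eq_bigr => s /andP[hs _].
  by have := comp_bound v s vc; case: eqP => //; lia.
have -> : \sum_(1 <= i < n.+1 | i != v) F (if i == v then n.+1 else comp c v i) = btw c n v.
  rewrite /btw; apply: eq_bigr => i /negbTE ->; rewrite /F; apply: eq_bigr => s _.
  by rewrite eq_sym.
lia.
Qed.

Lemma btw_upd_bounds c n v i : valid c -> 0 < v <= n -> 0 < i <= n ->
  btw c n v <= btw (upd c n i) n.+1 v <= btw c n v + 2 * n.
Proof.
move=> vc hv hi; rewrite btwS // (@btw_adapted _ _ (upd c n i) c) //; first last.
- exact: agree_sym (@upd_agree _ _ _).
- exact: upd_valid.
rewrite leq_addr leq_add2l leq_mul2l /=.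
apply: leq_trans (_ : \sum_(1 <= s < n.+1) 1 <= _).
  rewrite big_mkcond; apply: leq_sum => s _; case: ifP => // _; exact: leq_b1.
by rewrite sum_nat_const_nat subSS subn0 muln1.
Qed.

Lemma subtree_size_adapted n v : adapted n (fun c => subtree_size c n v).
Proof.
move=> c c' vc vc' ag; rewrite /subtree_size big_nat [RHS]big_nat.
by apply: eq_bigr => x hx; rewrite (comp_adapted _ _ vc vc' ag) //; lia.
Qed.

Lemma subtree_size_upd c n v i : valid c -> 0 < v <= n -> 0 < i <= n ->
  subtree_size (upd c n i) n.+1 v =
  subtree_size c n v + ((i == v) || (comp c v i != 0)).
Proof.
move=> vc hv hi; rewrite /subtree_size big_nat_recr //=; congr (_ + nat_of_bool _).
  rewrite big_nat [RHS]big_nat; apply: eq_bigr => x hx.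
  by rewrite comp_upd //; lia.
by rewrite comp_upd_new //; [case: (i == v) => /=; lia|lia].
Qed.

Section Martingales.
Context {R : realFieldType}.
Local Open Scope ring_scope.

Definition gap u v n c : R := (btw c n u)%:R - (btw c n v)%:R.

(** The additive term [2 * n.-1] of [sum_btw_upd] is the same for both vertices and cancels. *)
Lemma sum_gap_upd u v n c : valid c -> (0 < u <= n)%N -> (0 < v <= n)%N ->
  \sum_(1 <= i < n.+1) gap u v n.+1 (upd c n i) = n.+2%:R * gap u v n c.
Proof.
move=> vc hu hv; rewrite /gap sumrB -!natr_sum !sum_btw_upd // !natrD !natrM.
by ring.
Qed.

(* The factor makes [ngap] a martingale, since [sum_gap_upd] multiplies the
   conditional mean of [gap] by (n+2)/n. *)
Definition ngap u v n c : R := gap u v n c / (n%:R * n.+1%:R).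

Lemma ngap_adapted u v n : adapted n (ngap u v n).
Proof.
by move=> c c' vc vc' ag; rewrite /ngap /gap !(btw_adapted _ vc vc' ag).
Qed.

(** The mean square about [a] is the squared distance of the mean to [a] plus the variance. The
    variance is at most [4 / (n (n - 1))], written as a difference so that it telescopes in
    [ngap_maximal]. *)
Lemma avg_ngap_sqr u v n c (a : R) : valid c ->
  (0 < u <= n)%N -> (0 < v <= n)%N -> (1 < n)%N ->
  avg n (fun c => (ngap u v n.+1 c - a) ^+ 2) c <=
  (ngap u v n c - a) ^+ 2 + (4 / (n.-1)%:R - 4 / n%:R).
Proof.
move=> vc hu hv n1.
have n0 : n%:R != 0 :> R by rewrite pnatr_eq0; lia.
have nS0 k : k.+1%:R != 0 :> R by rewrite pnatr_eq0.
(* The old gap over the new normalisation: a reference point from which every outcome is at distance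
   at most [2 n / ((n + 1) (n + 2))]. *)
pose b : R := gap u v n c / (n.+1%:R * n.+2%:R).
pose x i : R := ngap u v n.+1 (upd c n i).
have sum_x : \sum_(1 <= i < n.+1) x i = n%:R * ngap u v n c.
  rewrite /x /ngap -mulr_suml sum_gap_upd //; field.
  by rewrite n0 nat1r nS0 -natrD (nS0 n.+1).
have dev i : (0 < i <= n)%N -> (x i - b) ^+ 2 <= 4 / (n.-1)%:R - 4 / n%:R.
  move=> hi; have /andP[u1 u2] := btw_upd_bounds vc hu hi.
  have /andP[v1 v2] := btw_upd_bounds vc hv hi.
  rewrite -!(ler_nat R) ?natrD ?natrM in u1 u2 v1 v2.
  have -> : x i - b = (gap u v n.+1 (upd c n i) - gap u v n c) / (n.+1%:R * n.+2%:R).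
    by rewrite /x /b /ngap [in RHS]mulrBl.
  set d := gap _ _ _ _ - _.
  have d2 : d ^+ 2 <= (2 * n%:R) ^+ 2.
    rewrite -real_normK ?num_real // lerXn2r ?nnegrE ?mulr_ge0 ?ler0n //.
    by rewrite ler_norml /d /gap; apply/andP; split; lra.
  have -> : 4 / n.-1%:R - 4 / n%:R = 4 / (n.-1%:R * n%:R) :> R.
    have n10 : n.-1%:R != 0 :> R by rewrite pnatr_eq0; lia.
    have e : n%:R = n.-1%:R + 1 :> R by rewrite natr1 prednK //; lia.
    by rewrite e in n0 *; field; rewrite n10 n0.
  rewrite expr_div_n ler_pdivrMr ?exprn_gt0 ?mulr_gt0 ?ltr0n //.
  apply: (le_trans d2); rewrite mulrAC ler_pdivlMr ?mulr_gt0 ?ltr0n; try lia.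
  rewrite -!natrM -!natrX -!natrM ler_nat; nia.
have key : avg n (fun c => (ngap u v n.+1 c - a) ^+ 2) c =
    (ngap u v n c - a) ^+ 2 + n%:R^-1 * \sum_(1 <= i < n.+1) (x i - b) ^+ 2
    - (ngap u v n c - b) ^+ 2.
  have sum_sqr t : \sum_(1 <= i < n.+1) (x i - t) ^+ 2 =
      \sum_(1 <= i < n.+1) x i ^+ 2 - 2 * t * (n%:R * ngap u v n c) + n%:R * t ^+ 2.
    rewrite (eq_bigr (fun i => x i ^+ 2 + (- (2 * t)) * x i + t ^+ 2)); last by move=> j _; ring.
    rewrite !big_split /= -mulr_sumr sum_x sumr_const_nat subSS subn0.
    by rewrite -[t ^+ 2 *+ n]mulr_natl mulNr.
  by rewrite /avg -/(x _) !sum_sqr; field.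
rewrite key -addrA lerD2l; apply: le_trans (_ : n%:R^-1 * \sum_(1 <= i < n.+1) (x i - b) ^+ 2 <= _).
  by rewrite gerBl sqr_ge0.
rewrite ler_pdivrMl ?ltr0n ?[leRHS]mulr_natl; last by lia.
have {}n1 : (n.+1 - 1)%N = n by rewrite subSS subn0.
rewrite -[X in _ *+ X]n1 -sumr_const_nat big_nat [X in _ <= X]big_nat.
by apply: ler_sum => i; rewrite ltnS; exact: dev.
Qed.

(** Adding the compensator [4 / (k - 1)] to the squared displacement since time [N] gives a
    supermartingale, whose value at time [N] is the compensator alone. *)
Lemma ngap_maximal u v N n c (e : R) : valid c -> (1 < N <= n)%N -> 0 < e ->
  (0 < u <= N)%N -> (0 < v <= N)%N ->
  Ex N n (fun c' => (has (fun k => e <= `|ngap u v k c' - ngap u v N c|)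
                        (index_iota N n.+1))%:R) c <= 4 / (N.-1)%:R / e ^+ 2.
Proof.
move=> vc /andP[N1 Nn] e0 hu hv; have N0 : (0 < N <= n)%N by lia.
pose W k c' : R := (ngap u v k c' - ngap u v N c) ^+ 2 + 4 / (k.-1)%:R.
have <- : W N c = 4 / (N.-1)%:R by rewrite /W subrr expr0n add0r.
apply: le_trans (maximal_inequality N0 vc (exprn_gt0 2 e0) _ _ _); last first.
- move=> k c' Nk vc' _ /=; have := @avg_ngap_sqr u v k c' (ngap u v N c) vc'.
  rewrite /W => H; have k0 : (0 < k)%N by lia.
  rewrite /avg big_split mulrDr /= -/(avg k (fun=> 4 / k%:R) c') avg_cst //.
  rewrite -lerBrDr; apply: le_trans (H _ _ _) _; try lia.
  by rewrite addrA.
- by move=> k c' _ _ _; rewrite addr_ge0 ?sqr_ge0 // divr_ge0.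
- move=> k Nk c1 c2 v1 v2 ag; congr (_ ^+ 2 + _); congr (_ - _).
  exact: (@ngap_adapted u v k).
apply: Ex_le => // c' _ _; rewrite ler_nat; case: hasP => // -[k hk ke].
rewrite lt0b; apply/hasP; exists k => //.
rewrite /W -[(_ - _) ^+ 2]real_normK ?num_real //.
by rewrite ler_wpDr ?divr_ge0 // lerXn2r // ?nnegrE // ltW.
Qed.

(** With [S] the subtree size, [S (S + 1) / (k (k + 1))] is a martingale, since [S] grows with
    probability [S / k]. It starts from [2 / (v (v + 1))], and [k <= 8 S] puts it above 1/64. *)
Lemma subtree_size_maximal v n c : valid c -> (0 < v <= n)%N ->
  Ex v n (fun c' => (has (fun k => k <= 8 * subtree_size c' k v)%N
                       (index_iota v n.+1))%:R) c <= 128 / (v%:R * v.+1%:R) :> R.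
Proof.
move=> vc hv; have v0 : (0 < v)%N by lia.
pose W k c' : R := (subtree_size c' k v)%:R * (subtree_size c' k v).+1%:R / (k%:R * k.+1%:R).
have <- : W v c / 64^-1 = 128 / (v%:R * v.+1%:R).
  rewrite /W (_ : subtree_size c v v = 1%N); first by rewrite invrK mulrAC; congr (_ / _); ring.
  rewrite /subtree_size big_nat_recr //= eqxx big_nat big1 // => i hi.
  by rewrite comp_le //; lia.
have a0 : (0 : R) < 64^-1 by rewrite invr_gt0.
apply: le_trans (maximal_inequality hv vc a0 _ _ _); last first.
- move=> k c' vk vc' _; have k0 : (0 < k)%N by lia.
  set S := subtree_size c' k v.
  pose d i := ((i == v) || (comp c' v i != 0))%N.
  have eW i : (0 < i <= k)%N -> W k.+1 (upd c' k i) =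
     (S%:R * S.+1%:R + 2 * S.+1%:R * (d i)%:R) / (k.+1%:R * k.+2%:R).
    move=> hi; rewrite /W subtree_size_upd ?v0 // -/(d i) -/S.
    by congr (_ / _); case: (d i) => /=; rewrite ?addn1 ?addn0 -!natr1; ring.
  rewrite /avg big_nat (eq_bigr _ eW) -big_nat -mulr_suml big_split /= -!mulr_sumr.
  rewrite sumr_const_nat subSS subn0 -natr_sum -[X in 2 * _ * X%:R]/S /W -/S.
  rewrite -[S.+1%:R *+ k]mulr_natl le_eqVlt; apply/orP; left; apply/eqP.
  rewrite -!natr1; field.
  by rewrite !natr1 !pnatr_eq0 //= -lt0n k0.
- by move=> k c' _ _ _; rewrite divr_ge0 ?mulr_ge0.
- by move=> k vk c1 c2 v1 v2 ag; rewrite /W (subtree_size_adapted v v1 v2 ag).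
apply: Ex_le => // c' _ _; rewrite ler_nat; case: hasP => // -[k hk ke].
have k0 : (0 < k)%N by move: hk; rewrite mem_index_iota; lia.
rewrite lt0b; apply/hasP; exists k => //; rewrite /W.
rewrite ler_pdivlMr ?mulr_gt0 ?ltr0n // ler_pdivrMl // -!natrM ler_nat; nia.
Qed.

End Martingales.

(** * Anticoncentration of the difference of two centralities *)

Definition twins m u v w w' (c : nat -> nat) :=
  [&& 0 < u, 0 < v, u != v, maxn u v < w <= m, maxn u v < w' <= m, w != w',
      c w.-1 == u & c w'.-1 == u].

(** As [w] and [w'] are children of [u], this is the union of their subtrees. *)
Definition in_block u w w' c x := (comp c u x == w) || (comp c u x == w').

Definition block_size c n u w := \sum_(1 <= x < n.+1) (comp c u x == w).

(* [c] and [c'] agree except that vertices later than [m] attached below [w] or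
   [w'] may be attached elsewhere below [w] or [w']. *)
Definition resplit m n u w w' (c c' : nat -> nat) :=
  agree m c c' /\ forall k, m <= k < n ->
    c k = c' k \/ in_block u w w' c (c k) /\ in_block u w w' c' (c' k).

Lemma twins_agree m u v w w' c c' : agree m c c' ->
  twins m u v w w' c -> twins m u v w w' c'.
Proof. by move=> ag; rewrite /twins; move=> h; rewrite -!ag //; lia. Qed.

Lemma in_block_gt m u v w w' c x : valid c -> twins m u v w w' c ->
  in_block u w w' c x -> maxn u v < x.
Proof.
move=> vc tw; have := comp_bound u x vc.
by move: tw; rewrite /twins /in_block; lia.
Qed.

(** The climb from [x] to [u] stays in the block, whose vertices are all younger than [v], so it
    does not meet [v]. *)
Lemma in_block_comp m u v w w' c x : valid c -> twins m u v w w' c ->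
  in_block u w w' c x -> comp c v x = comp c v u.
Proof.
move=> vc tw; have [k] := ubnP x; elim: k x => // k IH x xk bx.
have xv := in_block_gt vc tw bx; have lt : c x.-1 < x by apply: valid_lt => //; lia.
case: (eqVneq (c x.-1) u) => [e|ne].
  by rewrite comp_parent ?e //; move: tw; rewrite /twins; lia.
have bp : in_block u w w' c (c x.-1) by rewrite /in_block -comp_parent //; lia.
have pv := in_block_gt vc tw bp.
by rewrite comp_parent ?IH //; lia.
Qed.

(** Identifying the two labels turns the two blocks into one component, which no longer depends on
    how the block is split. *)
Definition merge w w' (y : nat) := if y == w' then w else y.

Lemma in_block_merge u w w' c x : in_block u w w' c x = (merge w w' (comp c u x) == w).
Proof. by rewrite /in_block /merge orbC; case: eqP => //= _; rewrite eqxx. Qed.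

(** By induction along parents: either the two parents coincide, or both lie in the block, where the
    label for [v] is that of [u] and the merged label for [u] is [w]. *)
Lemma resplit_comp m n u v w w' c c' x : valid c -> valid c' ->
  twins m u v w w' c -> resplit m n u w w' c c' -> x <= n ->
  comp c v x = comp c' v x /\
  merge w w' (comp c u x) = merge w w' (comp c' u x).
Proof.
move=> vc vc' tw [ag rs]; have tw' := twins_agree ag tw.
have um : u <= m /\ v <= m by move: tw; rewrite /twins; lia.
have [k] := ubnP x; elim: k x => // k IH x xk xn.
case: (leqP x m) => xm.
  have agx := agree_le xm ag.
  by rewrite !(comp_agree _ vc vc' agx).
have [] := rs x.-1 ltac:(lia).
  move=> e; have [h1 h2] := IH (c x.-1) ltac:(have := valid_lt (x := x) vc ltac:(lia); lia)
     ltac:(have := valid_lt (x := x) vc ltac:(lia); lia).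
  rewrite (compE v x vc) (compE u x vc) (compE v x vc') (compE u x vc') -e.
  have [-> ->] : (x <= v) = false /\ (x <= u) = false by lia.
  by split; case: eqP.
move=> [b b']; have g := in_block_gt vc tw b; have g' := in_block_gt vc' tw' b'.
rewrite (@comp_parent c v x) // 1?(@comp_parent c u x) // 1?(@comp_parent c' v x) //
  1?(@comp_parent c' u x) //; try lia.
rewrite (in_block_comp vc tw b) (in_block_comp vc' tw' b').
rewrite !in_block_merge in b b'; rewrite (eqP b) (eqP b').
by split=> //; apply: comp_agree => //; apply: agree_le ag; case: um.
Qed.

Lemma resplit_in_block m n u v w w' c c' x : valid c -> valid c' ->
  twins m u v w w' c -> resplit m n u w w' c c' -> x <= n ->
  in_block u w w' c x = in_block u w w' c' x.
Proof.
move=> vc vc' tw rs xn; rewrite !in_block_merge.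
by have [_ ->] := resplit_comp vc vc' tw rs xn.
Qed.

(** Merging the blocks loses exactly the ordered pairs with one endpoint in each. *)
Lemma btw_merge m n u v w w' c : valid c -> twins m u v w w' c -> u <= n ->
  btw c n u = \sum_(1 <= s < n.+1 | s != u) \sum_(1 <= t < n.+1 | t != u)
      (merge w w' (comp c u s) != merge w w' (comp c u t))
    + 2 * (block_size c n u w * block_size c n u w').
Proof.
move=> vc tw un.
have [w0 w0' ww] : [/\ w != 0, w' != 0 & w != w'] by move: tw; rewrite /twins; split; lia.
have u0 : 0 < u by case/andP: tw.
have nb y : y != 0 -> block_size c n u y = \sum_(1 <= x < n.+1 | x != u) (comp c u x == y).
  move=> y0; rewrite /block_size (@sum_pred1 _ u) ?u0 // comp_le //.
  by rewrite eq_sym (negbTE y0).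
rewrite !nb // /btw mul2n -addnn {2}mulnC !big_distrl /= -!big_split /=.
apply: eq_bigr => s _; rewrite !big_distrr /= -!big_split /=.
apply: eq_bigr => t _; rewrite /merge.
move: ww; move: (comp c u s) (comp c u t) => a b.
by case: (eqVneq a w') => ha; case: (eqVneq b w') => hb; lia.
Qed.

Lemma block_size_upd m n u v w w' c y i : valid c -> twins m u v w w' c -> m <= n ->
  0 < i <= n -> 0 < y <= n ->
  block_size (upd c n i) n.+1 u y = block_size c n u y + (comp c u i == y).
Proof.
move=> vc tw mn hi hy; rewrite /block_size big_nat_recr //=; congr (_ + nat_of_bool _).
  by rewrite big_nat [RHS]big_nat; apply: eq_bigr => x hx; rewrite comp_upd //; lia.
rewrite comp_upd_new //; last by move: tw; rewrite /twins; lia.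
by case: (eqVneq i u) => // ->; rewrite [in RHS]comp_le //; lia.
Qed.

Lemma block_size_sum m n u v w w' c : twins m u v w w' c ->
  block_size c n u w + block_size c n u w' = \sum_(1 <= x < n.+1) in_block u w w' c x.
Proof.
move=> tw; have ww : w != w' by move: tw; rewrite /twins; lia.
rewrite /block_size -big_split /=; apply: eq_bigr => x _.
by rewrite /in_block; case: eqP => [->|//]; rewrite (negbTE ww).
Qed.

Lemma block_size_gt0 m n u v w w' c : valid c -> twins m u v w w' c -> m <= n ->
  0 < block_size c n u w /\ 0 < block_size c n u w'.
Proof.
move=> vc tw mn; have H y : u < y -> 0 < y <= n -> c y.-1 = u -> 0 < block_size c n u y.
  move=> uy hy e; rewrite /block_size (@sum_pred1 _ y) //.
  by rewrite comp_child // eqxx.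
by move: tw; rewrite /twins => tw; split; apply: H; lia.
Qed.

Lemma resplit_upd m n u v w w' c c' i : valid c -> valid c' -> twins m u v w w' c ->
  m <= n -> 0 < i <= n -> resplit m n u w w' c c' ->
  resplit m n.+1 u w w' (upd c n i) (upd c' n i).
Proof.
move=> vc vc' tw mn hi [ag rs]; split=> [k km|k /andP[mk]].
  by rewrite /upd; case: eqP => // _; apply: ag.
rewrite ltnS leq_eqVlt => /orP[/eqP ->|kn]; first by left; rewrite /upd eqxx.
rewrite /upd (ltn_eqF kn); case: (rs k ltac:(lia)) => [|[b b']]; [by left|right].
have := vc k; have := vc' k => h h'.
by move: b b'; rewrite /in_block !comp_upd //; lia.
Qed.

Lemma resplit_upd_block m n u v w w' c i j : valid c -> twins m u v w w' c ->
  m <= n -> 0 < i <= n -> 0 < j <= n -> in_block u w w' c i -> in_block u w w' c j ->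
  resplit m n.+1 u w w' (upd c n i) (upd c n j).
Proof.
move=> vc tw mn hi hj bi bj; split=> [k km|k /andP[mk]].
  by rewrite /upd ltn_eqF //; lia.
rewrite ltnS leq_eqVlt => /orP[/eqP ->|kn]; last by left; rewrite /upd ltn_eqF.
by right; rewrite /upd eqxx; move: bi bj; rewrite /in_block !comp_upd //; lia.
Qed.

(** All solutions lie in a window of length [r] that starts at the smallest one. *)
Lemma sum_close_le (Q : pred nat) r a b :
  (forall i j, Q i -> Q j -> i <= j -> j < i + r) -> \sum_(a <= j < b) Q j <= r.
Proof.
move=> h; case: (pselect (exists i, Q i)) => [exQ|nQ]; last first.
  by rewrite big1 // => j _; case: (boolP (Q j)) => // qj; case: nQ; exists j.
have [i qi mini] := ex_minnP exQ.
rewrite (eq_bigr (fun j => if Q j then 1 else 0)); last by move=> j _; case: (Q j).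
rewrite -big_mkcond sum1_count -size_filter -[leqRHS](size_iota i); apply: uniq_leq_size.
  by rewrite filter_uniq // iota_uniq.
by move=> j; rewrite mem_filter mem_iota => /andP[qj _]; rewrite mini //= h // mini.
Qed.

(** * The Polya urn of the two blocks *)

Section Split.
Context {R : realFieldType}.
Local Open Scope ring_scope.

(** One draw from an urn with [j] balls of the first colour among [s]. After reindexing, [F j] has
    weight [(j - 1) + (s - j)], which is the same for all [j]; this keeps the bound on the atoms
    uniform. *)
Lemma urn_shift (F : nat -> R) s : (0 < s)%N ->
  \sum_(1 <= j < s) (j%:R * F j.+1 + (s - j)%:R * F j) =
  (s.-1)%:R * \sum_(1 <= j < s.+1) F j.
Proof.
move=> s0; rewrite big_split /=.
have -> : \sum_(1 <= j < s) j%:R * F j.+1 = \sum_(1 <= j < s.+1) (j.-1)%:R * F j.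
  by rewrite [RHS]big_ltn // mul0r add0r big_add1.
have -> : \sum_(1 <= j < s) (s - j)%:R * F j = \sum_(1 <= j < s.+1) (s - j)%:R * F j.
  by rewrite [RHS]big_nat_recr //= subnn mul0r addr0.
rewrite -big_split mulr_sumr /= big_nat [RHS]big_nat; apply: eq_bigr => j hj.
by rewrite -mulrDl -natrD; congr (_%:R * _); lia.
Qed.

Variables (m u v w w' : nat).
Let blk := in_block u w w'.
Let k1 n c := block_size c n u w.
Let s n c := (block_size c n u w + block_size c n u w')%N.

(** Plays the role of conditioning: [c] enters only through its [resplit] class, and the size of the
    first block only through the free argument [j]. *)
Definition resplit_invariant n (G : (nat -> nat) -> nat -> R) :=
  forall c c' j, valid c -> valid c' -> twins m u v w w' c ->
    resplit m n u w w' c c' -> G c j = G c' j.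

Lemma sum_block_upd n c (F : bool -> R) : valid c -> twins m u v w w' c ->
  \sum_(1 <= i < n.+1) F (blk c i) = (s n c)%:R * F true + (n - s n c)%:R * F false.
Proof.
move=> vc tw; rewrite /s (block_size_sum n tw) -/blk.
elim: n => [|n IH]; first by rewrite !big_geq // subn0 !mul0r addr0.
rewrite big_nat_recr //= IH.
have -> : (\sum_(1 <= x < n.+2) blk c x = \sum_(1 <= x < n.+1) blk c x + blk c n.+1)%N.
  by rewrite big_nat_recr.
set t := (\sum_(1 <= x < n.+1) blk c x)%N.
have tn : (t <= n)%N.
  apply: leq_trans (_ : \sum_(1 <= x < n.+1) 1 <= _)%N.
    by apply: leq_sum => x _; exact: leq_b1.
  by rewrite sum_nat_const_nat subSS subn0 muln1.
case: (blk c n.+1) => /=; first by rewrite addn1 subSS -natr1; ring.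
by rewrite addn0 subSn // -natr1; ring.
Qed.

Lemma blocks_size_upd n c i : valid c -> twins m u v w w' c -> (m <= n)%N -> (0 < i <= n)%N ->
  s n.+1 (upd c n i) = (s n c + blk c i)%N.
Proof.
move=> vc tw mn hi; have ww : w != w' by move: tw; rewrite /twins; lia.
rewrite /s !(block_size_upd vc tw) //; try by move: tw; rewrite /twins; lia.
by rewrite /blk /in_block; lia.
Qed.

Lemma blocks_size_gt1 n c : valid c -> twins m u v w w' c -> (m <= n)%N -> (1 < s n c)%N.
Proof. by move=> vc tw mn; have := block_size_gt0 vc tw mn; rewrite /s; lia. Qed.

Lemma blocks_size_le n c : valid c -> twins m u v w w' c -> (s n c <= n)%N.
Proof.
move=> vc tw; rewrite /s (block_size_sum n tw).
apply: leq_trans (_ : \sum_(1 <= x < n.+1) 1 <= _)%N.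
  by apply: leq_sum => x _; exact: leq_b1.
by rewrite sum_nat_const_nat subSS subn0 muln1.
Qed.

Lemma blocks_size_resplit n c c' : valid c -> valid c' -> twins m u v w w' c ->
  resplit m n u w w' c c' -> s n c = s n c'.
Proof.
move=> vc vc' tw rs; rewrite /s (block_size_sum n tw).
rewrite (block_size_sum n (twins_agree (proj1 rs) tw)) big_nat [RHS]big_nat.
by apply: eq_bigr => x hx; rewrite (resplit_in_block vc vc' tw rs) //; lia.
Qed.

(** An exact martingale: [s] grows with probability [s / n], and [1 + (n - s) / (s - 1) = (n - 1) /
    (s - 1)]. *)
Lemma Ex_block_size_inv n c : valid c -> twins m u v w w' c -> (m <= n)%N ->
  Ex m n (fun c => (n.-1)%:R / ((s n c).-1)%:R) c <= (m.-1)%:R / ((s m c).-1)%:R :> R.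
Proof.
move=> vc tw mn; have m0 : (0 < m)%N by move: tw; rewrite /twins; lia.
apply: (Ex_supermartingale (W := fun n c => (n.-1)%:R / ((s n c).-1)%:R)) => //.
  by rewrite m0.
move=> k c' mk vc' ag; have tw' := twins_agree ag tw.
have s1 := blocks_size_gt1 vc' tw' mk; have sk := blocks_size_le k vc' tw'.
rewrite /avg big_nat (eq_bigr (fun i => k%:R / (s k c' + blk c' i).-1%:R)); last first.
  by move=> i hi; rewrite (blocks_size_upd vc' tw') //.
rewrite -big_nat (sum_block_upd k (fun b : bool => k%:R / (s k c' + b).-1%:R)) //=.
rewrite addn1 addn0 /= le_eqVlt; apply/orP; left; apply/eqP.
move: (s k c') sk s1 => t; case: k {mk} => [|k]; first by lia.
case: t => [|[|t]] // sk _ /=.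
rewrite natrB // -!natr1; field.
by rewrite !natr1 !pnatr_eq0.
Qed.

(* Given the class of [c'] modulo [resplit], the size of the first block is a
   Polya urn of [s n c'] balls: each of its values has probability at most
   (s_m - 1) / (s_n - 1), since one more draw multiplies the largest atom by at
   most (s - 1) / s. *)
Lemma Ex_split_le n G c : valid c -> twins m u v w w' c -> (m <= n)%N ->
  (forall c j, 0 <= G c j) -> resplit_invariant n G ->
  Ex m n (fun c' => G c' (k1 n c')) c <=
  Ex m n (fun c' => (s m c).-1%:R / (s n c').-1%:R * \sum_(1 <= j < s n c') G c' j) c.
Proof.
move=> vc tw mn; have m0 : (0 < m)%N by move: tw; rewrite /twins; lia.
have sm0 : (s m c).-1%:R != 0 :> R.
  by rewrite pnatr_eq0; have := blocks_size_gt1 vc tw (leqnn m); lia.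
elim/Ex_ind: n / mn G => [|n mn IH] G G0 inv.
  (* At time [m] the left side is the single term [j = k1 m c] of the sum. *)
  rewrite !Exnn divff // mul1r.
  have [h1 h2] := block_size_gt0 vc tw (leqnn m).
  rewrite (bigD1_seq (k1 m c)) ?iota_uniq //=; last first.
    by rewrite mem_index_iota /k1 /s; lia.
  by rewrite lerDl sumr_ge0.
have hw : (0 < w <= n)%N by move: tw; rewrite /twins; lia.
(* The average of [G] over the place of vertex [n.+1] when the first block has size [j]. By
   invariance, every attachment inside the block can be replaced by one to [w]; [j] of them enlarge
   the first block. *)
pose G' c' j : R := n%:R^-1 * (\sum_(1 <= i < n.+1 | ~~ blk c' i) G (upd c' n i) j
   + (j%:R * G (upd c' n w) j.+1 + (s n c' - j)%:R * G (upd c' n w) j)).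
have wblk c' : valid c' -> twins m u v w w' c' -> blk c' w.
  move=> vc' tw'; rewrite /blk /in_block comp_child ?eqxx //;
    by move: tw'; rewrite /twins; lia.
have G_blk c' i j : valid c' -> twins m u v w w' c' -> (0 < i <= n)%N -> blk c' i ->
    G (upd c' n i) j = G (upd c' n w) j.
  move=> vc' tw' hi bi; apply: inv; try exact: upd_valid.
    by apply: (twins_agree (c := c')) => //; exact: agree_le (@upd_agree _ _ _).
  by apply: (resplit_upd_block vc' tw') => //; exact: wblk.
rewrite !ExS //.
have -> : Ex m n (avg n (fun c' => G c' (k1 n.+1 c'))) c = Ex m n (fun c' => G' c' (k1 n c')) c.
  apply: Ex_eq => // [|c' vc' ag]; first by rewrite m0.
  have tw' := twins_agree ag tw; rewrite /avg /G'; congr (_ * _).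
  rewrite (bigID (blk c')) /= addrC; congr (_ + _).
    rewrite big_nat_cond [RHS]big_nat_cond; apply: eq_bigr => i /andP[hi nb].
    rewrite /k1 (block_size_upd vc' tw') //.
    by move: nb; rewrite /blk /in_block negb_or => /andP[/negbTE-> _]; rewrite addn0.
  have ww : w != w' by move: tw; rewrite /twins; lia.
  have -> : (s n c' - k1 n c')%N = block_size c' n u w' by rewrite /s /k1 addKn.
  rewrite /k1 {2 4}/block_size !natr_sum !mulr_suml -big_split /=.
  rewrite big_mkcond big_nat [RHS]big_nat; apply: eq_bigr => i hi.
  rewrite (block_size_upd vc' tw') //.
  case: ifP => bi; last first.
    by move: bi; rewrite /blk /in_block => /norP[/negbTE-> /negbTE->]; rewrite !mul0r addr0.
  rewrite G_blk //; move: bi; rewrite /blk /in_block.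
  case: eqP => [->|_] /=; first by rewrite (negbTE ww) mul1r mul0r addr0 addn1.
  by move=> ->; rewrite mul1r mul0r add0r addn0.
apply: le_trans (IH G' _ _) _.
- move=> c' j; rewrite mulr_ge0 ?invr_ge0 // addr_ge0 ?sumr_ge0 //.
  by rewrite addr_ge0 // mulr_ge0.
- move=> c1 c2 j v1 v2 tw1 rs; rewrite /G' (blocks_size_resplit v1 v2 tw1 rs); congr (_ * (_ + _)).
    rewrite big_nat_cond [RHS]big_nat_cond; apply: eq_big => [i|i /andP[hi _]].
      case: (boolP (0 < i < n.+1)%N) => //= hi.
      by rewrite /blk (resplit_in_block v1 v2 tw1 rs) //; lia.
    apply: inv; try exact: upd_valid.
      by apply: (twins_agree (c := c1)) => //; exact: agree_le (@upd_agree _ _ _).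
    exact: (resplit_upd v1 v2 tw1).
  have invw j' : G (upd c1 n w) j' = G (upd c2 n w) j'.
    apply: inv; try exact: upd_valid.
      by apply: (twins_agree (c := c1)) => //; exact: agree_le (@upd_agree _ _ _).
    exact: (resplit_upd v1 v2 tw1).
  by rewrite !invw.
apply: Ex_le => // [|c' vc' ag]; first by rewrite m0.
have tw' := twins_agree ag tw; have s1 := blocks_size_gt1 vc' tw' mn.
have s10 : (s n c').-1%:R != 0 :> R by rewrite pnatr_eq0; lia.
have s0 : (s n c')%:R != 0 :> R by rewrite pnatr_eq0; lia.
(* The factor [s - 1] from [urn_shift] cancels the old denominator. On the right, the [s]
   attachments inside the block cancel the new denominator [s], and the two sides agree. *)
rewrite /G' -mulr_sumr big_split /= urn_shift; last by lia.
set a := (s m c).-1%:R.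
rewrite /avg [in leRHS](bigID (blk c')) /=.
have -> : \sum_(1 <= i < n.+1 | blk c' i) (a / (s n.+1 (upd c' n i)).-1%:R *
     \sum_(1 <= j < s n.+1 (upd c' n i)) G (upd c' n i) j)
   = (s n c')%:R * (a / (s n c')%:R * \sum_(1 <= j < (s n c').+1) G (upd c' n w) j).
  pose X := a / (s n c')%:R * \sum_(1 <= j < (s n c').+1) G (upd c' n w) j.
  have := sum_block_upd n (fun b => if b then X else 0) vc' tw'; rewrite mulr0 addr0 => <-.
  rewrite -big_mkcond /= big_nat_cond [RHS]big_nat_cond; apply: eq_bigr => i /andP[hi bi].
  rewrite (blocks_size_upd vc' tw') // bi addn1 /= /X; congr (_ * _).
  by apply: eq_bigr => j _; rewrite G_blk.
have -> : \sum_(1 <= i < n.+1 | ~~ blk c' i) (a / (s n.+1 (upd c' n i)).-1%:R *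
     \sum_(1 <= j < s n.+1 (upd c' n i)) G (upd c' n i) j)
   = a / (s n c').-1%:R * \sum_(1 <= j < s n c')
       \sum_(1 <= i < n.+1 | ~~ blk c' i) G (upd c' n i) j.
  rewrite exchange_big /= mulr_sumr.
  rewrite big_nat_cond [RHS]big_nat_cond; apply: eq_bigr => i /andP[hi /negbTE bi].
  by rewrite (blocks_size_upd vc' tw') // bi addn0.
rewrite le_eqVlt; apply/orP; left; apply/eqP.
have n0 : n%:R != 0 :> R by rewrite pnatr_eq0; lia.
by field; rewrite n0 s0 s10.
Qed.

(** [Q] is the merged count for [u] minus the centrality of [v], both constant on [resplit] classes
    by [resplit_comp]; the remaining term comes from [btw_merge]. *)
Lemma gap_split n c : valid c -> twins m u v w w' c -> (u <= n)%N ->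
  exists Q : (nat -> nat) -> R,
  [/\ forall c', valid c' -> agree m c c' ->
        gap u v n c' = Q c' + (2 * (k1 n c' * (s n c' - k1 n c')))%:R
    & forall c1 c2, valid c1 -> valid c2 -> twins m u v w w' c1 ->
        resplit m n u w w' c1 c2 -> Q c1 = Q c2].
Proof.
move=> vc tw un.
exists (fun c => (\sum_(1 <= s < n.+1 | s != u) \sum_(1 <= t < n.+1 | t != u)
      (merge w w' (comp c u s) != merge w w' (comp c u t)))%:R - (btw c n v)%:R).
split=> [c' vc' ag|c1 c2 v1 v2 tw1 rs].
  rewrite /gap (btw_merge vc' (twins_agree ag tw) un) natrD.
  by rewrite /s /k1 addKn; ring.
congr (_%:R - _%:R).
  rewrite big_nat_cond [RHS]big_nat_cond; apply: eq_bigr => x /andP[hx _].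
  rewrite big_nat_cond [RHS]big_nat_cond; apply: eq_bigr => y /andP[hy _].
  have [_ ->] := resplit_comp v1 v2 tw1 rs (x := x) ltac:(lia).
  by have [_ ->] := resplit_comp v1 v2 tw1 rs (x := y) ltac:(lia).
rewrite /btw big_nat_cond [RHS]big_nat_cond; apply: eq_bigr => x /andP[hx _].
rewrite big_nat_cond [RHS]big_nat_cond; apply: eq_bigr => y /andP[hy _].
have [-> _] := resplit_comp v1 v2 tw1 rs (x := x) ltac:(lia).
by have [-> _] := resplit_comp v1 v2 tw1 rs (x := y) ltac:(lia).
Qed.

(** On each half of the range [j (t - j)] is monotone, and two points at distance at least [r] on
    the same half have values at least [r ^ 2] apart. *)
Lemma count_parabola (q : R) t r :
  (\sum_(1 <= j < t) (`|q + (2 * (j * (t - j)))%:R| < (r ^ 2)%:R)%R <= 2 * r)%N.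
Proof.
pose Q j := (j < t)%N && (`|q + (2 * (j * (t - j)))%:R| < (r ^ 2)%:R).
(* The doubled values lie in an open interval of length [2 r ^ 2]. *)
have close i j : Q i -> Q j -> (i * (t - i) < j * (t - j) + r ^ 2)%N.
  move=> /andP[_]; rewrite ltr_norml => /andP[_ h1] /andP[_].
  rewrite ltr_norml => /andP[h2 _]; rewrite -(ltr_nat R) natrD.
  by move: h1 h2; rewrite !natrM; lra.
apply: (leq_trans (n := (\sum_(1 <= j < t) (Q j && (2 * j <= t)) +
    \sum_(1 <= j < t) (Q j && (t < 2 * j)))%N)).
  rewrite -big_split /= big_nat [X in (_ <= X)%N]big_nat; apply: leq_sum => j hj.
  rewrite /Q; have -> : (j < t)%N by lia.
  by case: (`|_| < _)%R => /=; case: (leqP (2 * j) t) => h; rewrite ?h; lia.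
rewrite mul2n -addnn; apply: leq_add; apply: sum_close_le => i j.
- move=> /andP[qi hi] /andP[qj hj] ij; have h := close _ _ qj qi.
  rewrite ltnNge; apply/negP => h'.
  have [f ej] : exists f, j = (i + r + f)%N by exists (j - (i + r))%N; lia.
  have [e et] : exists e, t = (2 * j + e)%N by exists (t - 2 * j)%N; lia.
  move: h; have -> : (t - j = j + e)%N by lia.
  have -> : (t - i = j + e + (r + f))%N by lia.
  by rewrite ej; nia.
- move=> /andP[qi hi] /andP[qj hj] ij; have h := close _ _ qi qj.
  have jt : (j < t)%N by case/andP: qj.
  rewrite ltnNge; apply/negP => h'.
  have [f ej] : exists f, j = (i + r + f)%N by exists (j - (i + r))%N; lia.
  have [e et] : exists e, i = (t - j + (r + f) + e)%N by exists (2 * i - t)%N; lia.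
  move: h; have -> : (t - i = t - j + (r + f))%N by lia.
  move: (t - j)%N et => x et; rewrite ej et; nia.
Qed.

(** Given the [resplit] class, at most [2 r] sizes of the first block are bad, each of weight
    [(s_m - 1) / (s_n - 1)]; then [Ex_block_size_inv] averages over the random [s_n]. *)
Lemma gap_anticoncentration n c r : valid c -> twins m u v w w' c -> (m <= n)%N ->
  Ex m n (fun c' => (`|gap u v n c'| < (r ^ 2)%:R :> R)%:R) c
    <= (2 * r * m.-1)%:R / (n.-1)%:R :> R.
Proof.
move=> vc tw mn; have m0 : (0 < m <= n)%N by move: tw; rewrite /twins; lia.
have un : (u <= n)%N by move: tw; rewrite /twins; lia.
have n1 : (1 < n)%N by move: tw; rewrite /twins; lia.
have sm0 : (s m c).-1%:R != 0 :> R.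
  by rewrite pnatr_eq0; have := blocks_size_gt1 vc tw (leqnn m); lia.
have [Q [gQ invQ]] := gap_split vc tw un.
pose G c' j : R := (`|Q c' + (2 * (j * (s n c' - j)))%:R| < (r ^ 2)%:R :> R)%:R.
have -> : Ex m n (fun c' => (`|gap u v n c'| < (r ^ 2)%:R :> R)%:R) c =
   Ex m n (fun c' => G c' (k1 n c')) c.
  by apply: Ex_eq => // c' vc' ag; rewrite gQ.
apply: le_trans (Ex_split_le vc tw mn _ _) _.
- by move=> c' j; rewrite /G ler0n.
- move=> c1 c2 j v1 v2 tw1 rs.
  by rewrite /G (blocks_size_resplit v1 v2 tw1 rs) (invQ c1 c2).
apply: le_trans (_ : Ex m n (fun c' => ((s m c).-1 * (2 * r))%:R / (n.-1)%:R *
    ((n.-1)%:R / ((s n c').-1)%:R)) c <= _).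
  apply: Ex_le => // c' vc' ag; have tw' := twins_agree ag tw.
  have s1 := blocks_size_gt1 vc' tw' mn.
  rewrite mulrA mulfVK ?pnatr_eq0 -?lt0n; last by lia.
  rewrite natrM mulrAC ler_wpM2r ?invr_ge0 // ler_wpM2l //.
  by rewrite -natr_sum ler_nat count_parabola.
rewrite ExZ //; apply: le_trans (ler_wpM2l _ (Ex_block_size_inv vc tw mn)) _.
  by rewrite divr_ge0.
rewrite le_eqVlt; apply/orP; left; apply/eqP.
rewrite !natrM; field.
by rewrite sm0 pnatr_eq0; lia.
Qed.

End Split.

(** * Two fixed vertices: waiting for twins, then settling of their order *)

Definition no_child u a b (c : nat -> nat) := all (fun k => c k != u) (index_iota a b).

Lemma no_child_adapted u a b : adapted b (no_child u a b).
Proof.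
move=> c c' _ _ ag; apply: eq_in_all => k; rewrite mem_index_iota => /andP[_ kb].
by rewrite ag.
Qed.

Lemma no_childS u a b c : a <= b -> no_child u a b.+1 c = no_child u a b c && (c b != u).
Proof.
by move=> ab; rewrite /no_child /index_iota subSn // -addn1 iotaD all_cat /= subnKC // andbT.
Qed.

(** As [c k] is the parent of [k.+1], the window from [a] to [b] concerns the vertices [a.+1] to
    [b]; one child is taken from each of two consecutive windows. *)
Lemma twins_intro u v a b m c : valid c -> 0 < u -> 0 < v -> u != v -> maxn u v < a ->
  ~~ no_child u a b c -> ~~ no_child u b m c -> a <= b <= m ->
  exists w w', twins m u v w w' c.
Proof.
move=> vc u0 v0 uv ha /allPn[k hk ck] /allPn[k' hk' ck'] abm.
rewrite !mem_index_iota !negbK in hk ck hk' ck'.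
by exists k.+1, k'.+1; rewrite /twins /= ck ck' u0 v0 uv; lia.
Qed.

(** The two times come in either order and ties count on both sides, so that a change of center by
    tie-breaking is covered. *)
Definition crosses u v N M (c : nat -> nat) :=
  has (fun n => has (fun n' => (btw c n u <= btw c n v) && (btw c n' v <= btw c n' u))
    (index_iota N M.+1)) (index_iota N M.+1).

Section Settle.
Context {R : archiRealFieldType}.
Local Open Scope ring_scope.

Lemma natr_bool_le1 (b : bool) : b%:R <= 1 :> R.
Proof. by case: b => /=; rewrite ?ler01 ?lexx. Qed.

Lemma Ex_adapted m n (f : (nat -> nat) -> R) c : (0 < m <= n)%N -> valid c ->
  adapted m f -> Ex m n f c = f c.
Proof.
move=> mn vc ad; rewrite -[RHS](Ex_cst _ c mn); apply: Ex_eq => // c' vc' ag.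
exact/esym/ad.
Qed.

Lemma Ex_cond_le a b m (f : (nat -> nat) -> R) c (K : R) : (0 < a <= b)%N -> (b <= m)%N ->
  valid c -> adapted b f -> (forall c', valid c' -> Ex a b f c' <= K) ->
  Ex 1 m f c <= K.
Proof.
move=> ab bm vc ad h; rewrite (@Ex_tower _ 1 b m); last by lia.
rewrite (@Ex_eq _ 1 b _ f) //; first last.
- by move=> c' vc' _; apply: Ex_adapted => //; lia.
- by lia.
rewrite (@Ex_tower _ 1 a b); last by lia.
rewrite -[leRHS](@Ex_cst _ 1 a K c); last by lia.
by apply: Ex_le => // [|c' vc' _]; [lia|exact: h].
Qed.

(** Vertex [n.+1] avoids [u] with probability [(n - 1) / n], so [n - 1] times the indicator is a
    supermartingale. *)
Lemma Ex_no_child u a b c : valid c -> (0 < u <= a)%N -> (1 < a <= b)%N ->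
  Ex a b (fun c' => (no_child u a b c')%:R) c <= (a.-1)%:R / (b.-1)%:R :> R.
Proof.
move=> vc hu /andP[a1 ab]; rewrite ler_pdivlMr ?ltr0n; last by lia.
rewrite mulrC -ExZ //.
have hW : (0 < a <= b)%N by lia.
have <- : (a.-1)%:R * (no_child u a a c)%:R = (a.-1)%:R :> R.
  by rewrite /no_child /index_iota subnn mulr1.
apply: (Ex_supermartingale (W := fun n c => (n.-1)%:R * (no_child u a n c)%:R)) => //.
move=> k c' ak vc' _.
rewrite /avg -mulr_sumr mulrA [_ * k.+1.-1%:R]mulVf ?pnatr_eq0 -?lt0n; last by lia.
rewrite mul1r -/(no_child u a k c').
have E i : (0 < i <= k)%N ->
    (no_child u a k.+1 (upd c' k i))%:R = (no_child u a k c' && (i != u))%:R :> R.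
  move=> hi; rewrite no_childS // {2}/upd eqxx.
  rewrite (no_child_adapted _ _ (upd_valid vc' hi) vc') //.
  exact: agree_sym (@upd_agree _ _ _).
rewrite big_nat (eq_bigr _ E) -big_nat; case: (no_child u a k c') => /=; last first.
  by rewrite big1 // mulr0.
rewrite mulr1 -natr_sum ler_nat.
rewrite (@sum_pred1 _ u); last by lia.
have := @sum_pred1 k u (fun=> 1%N) ltac:(lia).
rewrite sum_nat_const_nat subSS subn0 muln1 eqxx /= => e.
rewrite add0n [X in (X <= _)%N](eq_bigr (fun=> 1%N)); last by move=> i ->.
lia.
Qed.

Lemma exists_large (x y : R) a : 0 < x -> 0 <= y ->
  exists b, (a <= b)%N /\ forall n, (b <= n)%N -> y / (n.-1)%:R <= x.
Proof.
move=> x0 y0; have := archi_boundP (divr_ge0 y0 (ltW x0)).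
move: (Num.bound _) => B hB; exists (a + B).+2; split; first by lia.
move=> n hn; rewrite ler_pdivrMr ?ltr0n; last by lia.
rewrite mulrC -ler_pdivrMr //; apply: le_trans (ltW hB) _.
by rewrite ler_nat; lia.
Qed.

(** Up to probability [e / 2], [u] gets a child in each of the windows from [a] to [b] and from [b]
    to [m]. With these twins the gap at a much later [N] is at least [r ^ 2], of order [N ^ 2], up
    to another [e / 2]. *)
Lemma ngap_anticoncentration u v c (e : R) : valid c -> (0 < u)%N -> (0 < v)%N ->
  u != v -> 0 < e ->
  exists d, 0 < d /\ exists N0, forall N, (N0 <= N)%N ->
    Ex 1 N (fun c' => (`|ngap u v N c'| < d :> R)%:R) c <= e.
Proof.
move=> vc u0 v0 uv e0; pose a := (maxn u v).+1.
have e4 : 0 < e / 4 by rewrite divr_gt0.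
have [b [ab hb]] := @exists_large (e / 4) (a.-1)%:R a e4 (ler0n _ _).
have [m [bm hm]] := @exists_large (e / 4) (b.-1)%:R b e4 (ler0n _ _).
(* With [r] about [N / q], the bound [2 r (m - 1) / (N - 1)] is of order [m / q], which this [q]
   makes small against [e]. *)
pose q := (Num.bound (16 * m%:R / e)).+1.
have q0 : 0 < q%:R :> R by rewrite ltr0n.
have hq : 16 * m%:R <= e * q%:R.
  rewrite -ler_pdivrMl // mulrC; apply: le_trans (ltW (archi_boundP _)) _.
    by rewrite divr_ge0 ?mulr_ge0 // ltW.
  by rewrite ler_nat.
exists (2 * q%:R ^+ 2)^-1; split; first by rewrite invr_gt0 mulr_gt0 // exprn_gt0.
exists (m + q).+2 => N hN.
pose r := (N %/ q).+1.
have rq : (N < r * q)%N by rewrite /r mulSn addnC {1}(divn_eq N q) ltn_add2l ltn_pmod.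

have rq' : (r * q <= 2 * N.-1)%N.
  by rewrite /r mulSn; have := leq_trunc_div N q; lia.
have mN : (m <= N)%N by lia.
have small : (2 * r * m.-1)%:R / (N.-1)%:R <= e / 2.
  rewrite ler_pdivrMr ?ltr0n; last by lia.
  rewrite -(ler_pM2r q0); apply: (le_trans (y := 4 * m%:R * (N.-1)%:R)).
    rewrite -!natrM ler_nat.
    have : (2 * r * m.-1 * q = 2 * m.-1 * (r * q))%N by ring.
    move=> ->; apply: leq_trans (_ : 2 * m.-1 * (2 * N.-1) <= _)%N.
      by rewrite leq_mul2l rq' orbT.
    by have := leq_pred m; nia.
  rewrite [leRHS]mulrAC ler_wpM2r //; have := ler0n R m; lra.
(* For [d = 1 / (2 q ^ 2)] one has [d N (N + 1) <= r ^ 2], because [N < r q]. *)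
have large c' : `|ngap u v N c'| < (2 * q%:R ^+ 2)^-1 :> R -> `|gap u v N c'| < (r ^ 2)%:R :> R.
  have NN : 0 < N%:R * N.+1%:R :> R by rewrite mulr_gt0 ?ltr0n //; lia.
  have q2 : 0 < 2 * q%:R ^+ 2 :> R by rewrite mulr_gt0 // exprn_gt0.
  rewrite /ngap normrM normfV (gtr0_norm NN) ltr_pdivrMr // mulrC ltr_pdivlMr // => h.
  rewrite -(ltr_pM2r q2); apply: (lt_le_trans h).
  rewrite -!natrX -!natrM ler_nat.
  have : (r ^ 2 * (2 * q ^ 2) = 2 * (r * q) ^ 2)%N by ring.
  move=> ->; apply: leq_trans (_ : 2 * N ^ 2 <= _)%N; first by nia.
  by rewrite leq_mul2l leq_exp2r // ltnW.
pose nc1 c' : R := (no_child u a b c')%:R.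
pose nc2 c' : R := (no_child u b m c')%:R.
rewrite (@Ex_tower _ 1 m N); last by lia.
apply: (le_trans (y := Ex 1 m (fun c' => nc1 c' + nc2 c' + e / 2) c)).
  apply: Ex_le => // [|c' vc' _]; first by lia.
  have mN0 : (0 < m <= N)%N by lia.
  case: (boolP (no_child u a b c' || no_child u b m c')) => [h|].
    apply: (le_trans (y := 1)).
      rewrite -[leRHS](Ex_cst 1 c' mN0); apply: Ex_le => // c'' _ _; exact: natr_bool_le1.
    rewrite /nc1 /nc2; move: h; case: (no_child u a b c'); case: (no_child u b m c') => //= _; lra.
  rewrite negb_or => /andP[n1 n2].
  have [w [w' tw]] := twins_intro vc' u0 v0 uv (ltnSn _) n1 n2 ltac:(lia).
  apply: le_trans (_ : e / 2 <= _); last by rewrite lerDr addr_ge0 ?ler0n.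
  apply: le_trans small; apply: le_trans (gap_anticoncentration r vc' tw mN).
  apply: Ex_le => // c'' _ _; rewrite ler_nat; case: (boolP (_ < _)) => // /large ->.
  by [].
rewrite !ExD ?Ex_cst; try lia.
have h1 : Ex 1 m nc1 c <= e / 4.
  apply: (@Ex_cond_le a b) => //; try lia.
    by move=> c1 c2 v1 v2 ag; rewrite /nc1 (no_child_adapted _ _ v1 v2 ag).
  move=> c' vc'; apply: le_trans (hb b (leqnn b)).
  by apply: Ex_no_child => //; lia.
have h2 : Ex 1 m nc2 c <= e / 4.
  apply: (@Ex_cond_le b m) => //; try lia.
    by move=> c1 c2 v1 v2 ag; rewrite /nc2 (no_child_adapted _ _ v1 v2 ag).
  move=> c' vc'; apply: le_trans (hm m (leqnn m)).
  by apply: Ex_no_child => //; lia.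
lra.
Qed.

(** If [ngap] is at least [d] in absolute value at time [N], then at one of the two crossing times
    it is zero or of the opposite sign, hence has moved by at least [d]. *)
Lemma crosses_bound u v N M c (d : R) :
  (N <= M)%N -> 0 < d -> crosses u v N M c ->
  (`|ngap u v N c| < d) || has (fun n => d <= `|ngap u v n c - ngap u v N c|) (index_iota N M.+1).
Proof.
move=> NM d0 /hasP[n hn /hasP[n' hn' /andP[h h']]].
case: ltrP => //= dN; apply/hasP.
have sgn (k x y : nat) : (btw c k x <= btw c k y)%N -> ngap x y k c <= 0 :> R.
  move=> hk; have hg : gap x y k c <= 0 :> R by rewrite /gap subr_le0 ler_nat.
  by rewrite /ngap mulr_le0_ge0 // invr_ge0 mulr_ge0.
have g1 := sgn _ _ _ h.
have g2 : 0 <= ngap u v n' c :> R.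
  by rewrite -oppr_le0 /ngap -mulNr /gap opprB; exact: sgn.
move: dN; rewrite ler_normr => /orP[dN|dN]; [exists n => //|exists n' => //].
  by rewrite ler_normr; apply/orP; right; lra.
by rewrite ler_normr; apply/orP; left; lra.
Qed.

Lemma crosses_unlikely u v c (e : R) : valid c -> (0 < u)%N -> (0 < v)%N -> u != v ->
  0 < e -> exists N0, forall N, (N0 <= N)%N -> forall M, (N <= M)%N ->
    Ex 1 M (fun c' => (crosses u v N M c')%:R) c <= e.
Proof.
move=> vc u0 v0 uv e0.
have e2 : 0 < e / 2 by rewrite divr_gt0.
(* [d] is fixed first; [N] is then taken large enough for the fluctuation bound
   [4 / ((N - 1) d ^ 2)]. *)
have [d [d0 [N0 hN0]]] := ngap_anticoncentration vc u0 v0 uv e2.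
have y0 : 0 <= 4 / d ^+ 2 :> R by rewrite divr_ge0 // exprn_ge0 // ltW.
have [N1 [_ hN1]] := exists_large 0 e2 y0.
exists (N0 + N1 + u + v).+2 => N hN M NM.
pose close c' : R := (`|ngap u v N c'| < d :> R)%:R.
pose far c' : R :=
  (has (fun n => d <= `|ngap u v n c' - ngap u v N c'| :> R) (index_iota N M.+1))%:R.
apply: (le_trans (y := Ex 1 M (fun c' => close c' + far c') c)).
  apply: Ex_le => // [|c' vc' _]; first by lia.
  rewrite /close /far; case: (boolP (crosses _ _ _ _ _)) => [h|_]; last by rewrite addr_ge0.
  have := crosses_bound NM d0 h; rewrite -natrD ler_nat.
  by case: (_ < _)%R; case: has.
rewrite ExD; last by lia.
have h1 : Ex 1 M close c <= e / 2.
  rewrite (@Ex_tower _ 1 N M); last by lia.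
  apply: le_trans (hN0 N _); last by lia.
  apply: Ex_le => // [|c' vc' _]; first by lia.
  rewrite Ex_adapted //; first by lia.
  by move=> c1 c2 v1 v2 ag; rewrite /close (ngap_adapted u v v1 v2 ag).
have h2 : Ex 1 M far c <= e / 2.
  rewrite (@Ex_tower _ 1 N M); last by lia.
  rewrite -[leRHS](@Ex_cst _ 1 N _ c); last by lia.
  apply: Ex_le => // [|c' vc' _]; first by lia.
  apply: le_trans (hN1 N _); last by lia.
  rewrite mulrAC.
  apply: le_trans (@ngap_maximal _ u v N M c' d vc' _ d0 _ _); try lia.
  apply: Ex_le => // [|c'' vc'' ag]; first by lia.
  by rewrite /far (ngap_adapted u v vc' vc'' ag).
lra.
Qed.

Lemma eventually_forall_lt (Q : nat -> nat -> Prop) K :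
  (forall i, (i < K)%N -> exists N0, forall N, (N0 <= N)%N -> Q i N) ->
  exists N0, forall N, (N0 <= N)%N -> forall i, (i < K)%N -> Q i N.
Proof.
elim: K => [|K IH] h; first by exists 0%N.
have [N1 h1] := IH (fun i iK => h i (ltnW iK)); have [N2 h2] := h K (ltnSn K).
exists (N1 + N2)%N => N hN i; rewrite ltnS leq_eqVlt => /orP[/eqP->|iK].
  by apply: h2; lia.
by apply: h1 => //; lia.
Qed.

End Settle.

(** * The finitary theorem *)

Definition is_center c n v := 0 < v <= n /\ forall x, 0 < x <= n ->
  (btw c n x < btw c n v) || ((btw c n v == btw c n x) && (x <= v)).

(** Of two separated vertices at least one has a nonzero label, that is, lies below [v]. *)
Lemma btw_le c n v : btw c n v <= 2 * n * subtree_size c n v.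
Proof.
have dsum : \sum_(1 <= x < n.+1) (comp c v x != 0) <= subtree_size c n v.
  by apply: leq_sum => x _; case: (x == v) => //=; exact: leq_b1.
apply: leq_trans (_ : \sum_(1 <= s < n.+1) \sum_(1 <= t < n.+1)
   ((comp c v s != 0) + (comp c v t != 0)) <= _).
  rewrite /btw big_mkcond; apply: leq_sum => s _; case: ifP => // _.
  rewrite big_mkcond; apply: leq_sum => t _; case: ifP => // _.
  by lia.
under eq_bigr do rewrite big_split /= sum_nat_const_nat subSS subn0.
rewrite big_split /= sum_nat_const_nat subSS subn0 -big_distrr /=.
by rewrite addnn -mul2n mulnA leq_mul2l dsum orbT.
Qed.

Lemma comp_root c x : valid c -> 1 < x -> comp c 1 x != 0.
Proof.
move=> vc; have [k] := ubnP x; elim: k x => // k IH x xk x1.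
rewrite compE // leqNgt x1 /=; case: (eqVneq (c x.-1) 1) => [_|ne]; first by lia.
have lt := valid_lt vc (ltnW x1).
by apply: IH; [lia|have := vc x.-1; lia].
Qed.

(** Take the last vertex [v] whose subtree holds at least half of the vertices. Each component of
    the tree minus [v] then has at most [n / 2] vertices, so every [s] is separated from about half
    of the others. *)
Lemma exists_centroid c n : valid c -> 0 < n ->
  exists v, 0 < v <= n /\ n.-1 * n.-2 <= 2 * btw c n v.
Proof.
move=> vc n0; pose Q v := (0 < v <= n) && (n <= 2 * subtree_size c n v).
have exQ : exists v, Q v.
  exists 1; rewrite /Q n0 /= /subtree_size.
  rewrite big_nat (eq_bigr (fun=> 1)) -?big_nat ?sum_nat1 ?leq_pmull // => x hx.
  by case: (eqVneq x 1) => //= ?; rewrite comp_root //; lia.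
have bQ v : Q v -> v <= n by case/andP => /andP[].
have [v /andP[hv hS] maxv] := ex_maxnP exQ bQ.
exists v; split=> //.
have half s : 0 < s <= n -> s != v ->
    n.-2 <= 2 * \sum_(1 <= t < n.+1 | t != v) (comp c v s != comp c v t).
  move=> hs sv.
  have tot : \sum_(1 <= t < n.+1 | t != v) (comp c v s != comp c v t) +
      \sum_(1 <= t < n.+1 | t != v) (comp c v t == comp c v s) = n.-1.
    rewrite -(sum_neq1 hv).
    by rewrite -big_split /=; apply: eq_bigr => t _; rewrite eq_sym; case: eqP.
  suff : 2 * \sum_(1 <= t < n.+1 | t != v) (comp c v t == comp c v s) <= n by lia.
  (* The component above [v] is the complement of its subtree; one below has a top vertex [y > v],
     and its size is bounded by maximality of [v]. *)
  case: (eqVneq (comp c v s) 0) => [->|y0].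
    have := sum_nat1 n; have := sum_pred1 (fun x => ((x == v) || (comp c v x != 0)) : nat) hv.
    rewrite (sum_pred1 (fun=> 1) hv) eqxx -/(subtree_size c n v) => e1 e2.
    have : \sum_(1 <= t < n.+1 | t != v) (comp c v t == 0) +
        \sum_(1 <= t < n.+1 | t != v) (((t == v) || (comp c v t != 0)) : nat) =
        \sum_(1 <= t < n.+1 | t != v) 1.
      by rewrite -big_split /=; apply: eq_bigr => t /negbTE ->; case: eqP.
    lia.
  have [vy _] := comp_desc vc erefl y0; set y := comp c v s in y0 vy *.
  have yn : y <= n by apply: leq_trans (comp_bound v s vc) _; lia.
  have : ~~ Q y by apply/negP => /maxv; lia.
  rewrite /Q negb_and => /orP[|]; first by lia.
  rewrite -ltnNge => h; apply: leq_trans (ltnW h); rewrite leq_mul2l /=.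
  rewrite big_mkcond /subtree_size; apply: leq_sum => t _.
  case: ifP => // _; case: eqP => // e.
  by have [_ ->] := comp_desc vc e y0.
rewrite /btw big_distrr /=.
apply: leq_trans (_ : \sum_(1 <= s < n.+1 | s != v) n.-2 <= _).
  rewrite -{1}(sum_neq1 hv).
  rewrite /= big_distrl /= leq_eqVlt; apply/orP; left; apply/eqP.
  by apply: eq_bigr => s _; rewrite mul1n.
rewrite big_nat_cond [X in _ <= X]big_nat_cond; apply: leq_sum => s /andP[hs sv].
by apply: half => //; lia.
Qed.

(** Comparing the center with a centroid gives [(n - 1) (n - 2) <= 4 n S] for its subtree size
    [S]. *)
Lemma center_large c n v : valid c -> 5 < n -> is_center c n v ->
  n <= 8 * subtree_size c n v.
Proof.
move=> vc n5 [hv hc]; have [x [hx bx]] := exists_centroid vc (ltn_trans (ltn0Sn 4) n5).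
have := btw_le c n v; have := hc x hx => h1 h2.
have {}h1 : btw c n x <= btw c n v by lia.
have h3 : n.-1 * n.-2 <= 2 * (2 * n * subtree_size c n v) by lia.
move: (subtree_size c n v) h3 => S h3; rewrite -(leq_pmul2l (ltn_trans (ltn0Sn 4) n5)).
by case: n n5 h3 {hv hc hx bx h1 h2} => [|[|n]] //=; nia.
Qed.

(** [x <= N] makes [x] a competitor of [y] already at time [N]. *)
Lemma centers_cross c N M n x y : N <= n <= M -> is_center c n x -> is_center c N y ->
  x <= N -> crosses y x N M c.
Proof.
move=> nNM [x0 hx] [y0 hy] xN; apply/hasP; exists n; first by rewrite mem_index_iota; lia.
apply/hasP; exists N; first by rewrite mem_index_iota; lia.
have := hx y ltac:(lia); have := hy x ltac:(lia); lia.
Qed.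

(** * Stability of the center, uniformly in the horizon *)

Section CenterStable.
Context {R : archiRealFieldType}.
Local Open Scope ring_scope.

Lemma sum_inv_le L M : (L <= M)%N ->
  \sum_(L.+1 <= v < M.+1) (v%:R * v.+1%:R)^-1 <= (L.+1%:R)^-1 :> R.
Proof.
move=> LM; suff -> : \sum_(L.+1 <= v < M.+1) (v%:R * v.+1%:R)^-1 =
    (L.+1%:R)^-1 - (M.+1%:R)^-1 :> R by rewrite gerBl invr_ge0.
have -> : (L.+1%:R)^-1 - (M.+1%:R)^-1 = - (M.+1%:R)^-1 - - (L.+1%:R)^-1 :> R by ring.
rewrite -(telescope_sumr (fun v => - (v%:R : R)^-1)) //; apply: eq_big_nat => v hv.
have v0 : v%:R != 0 :> R by rewrite pnatr_eq0; lia.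
rewrite -!natr1; field; rewrite v0 natr1 pnatr_eq0 //.
Qed.

(** If the center moves, then either a vertex beyond [L] has at some time an eighth of the tree
    below it, or two vertices up to [L] cross. The first has probability at most [128 / L.+1]; a
    union bound over pairs treats the second. *)
Lemma center_stable (ctr : nat -> (nat -> nat) -> nat) c (e : R) :
  (forall n c', (0 < n)%N -> valid c' -> is_center c' n (ctr n c')) ->
  valid c -> 0 < e ->
  exists N, (0 < N)%N /\ forall M, (N <= M)%N ->
    Ex 1 M (fun c' => (has (fun n => ctr n c' != ctr N c') (index_iota N M.+1))%:R) c <= e.
Proof.
move=> hctr vc e0.
have e2 : 0 < e / 2 by rewrite divr_gt0.
have [L [L0 hL]] := @exists_large R (e / 2) 128 2 e2 ltac:(by []).
have {}hL := hL L (leqnn L); have {L L0 hL} [L hL] : exists L, 128 / L.+1%:R <= e / 2 :> R.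
  by exists L.-2; move: hL; case: L L0 => [|[|L]].
have L2 : 0 < (L ^ 2).+1%:R :> R by rewrite ltr0n.
(* The share of each ordered pair; the successor keeps the denominator positive when [L] is 0. *)
have e3 : 0 < e / 2 / (L ^ 2).+1%:R by rewrite divr_gt0.
have [N0 hN0] : exists N0, forall N, (N0 <= N)%N -> forall u, (u < L)%N -> forall v, (v < L)%N ->
    u != v -> forall M, (N <= M)%N ->
    Ex 1 M (fun c' => (crosses u.+1 v.+1 N M c')%:R) c <= e / 2 / (L ^ 2).+1%:R.
  apply: (@eventually_forall_lt (fun u N => forall v, (v < L)%N -> u != v ->
    forall M, (N <= M)%N -> Ex 1 M (fun c' => (crosses u.+1 v.+1 N M c')%:R) c <= _)).
  move=> u uL; apply: (@eventually_forall_lt (fun v N => u != v ->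
    forall M, (N <= M)%N -> Ex 1 M (fun c' => (crosses u.+1 v.+1 N M c')%:R) c <= _)).
  move=> v vL; case: (eqVneq u v) => [->|uv]; first by exists 0%N.
  have [N0 hN0] := crosses_unlikely (u := u.+1) (v := v.+1) vc isT isT uv e3.
  by exists N0 => N hN _; exact: hN0.
(* [L <= N] serves [centers_cross], and [5 < N] serves [center_large]. *)
have [N [NN0 LN N6]] : exists N, [/\ N0 <= N, L <= N & 5 < N]%N.
  by exists (N0 + L + 6)%N; split; lia.
have N1 : (0 < N)%N by apply: leq_ltn_trans N6.
exists N; split=> // M NM; have M1 : (0 < 1 <= M)%N by exact: leq_trans NM.
pose big v c' := has (fun k => k <= 8 * subtree_size c' k v)%N (index_iota v M.+1).
apply: (le_trans (y := Ex 1 M (fun c' => \sum_(L.+1 <= v < M.+1) (big v c')%:R +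
    \sum_(0 <= u < L) \sum_(0 <= v < L) ((u != v) && crosses u.+1 v.+1 N M c')%:R) c)).
  apply: Ex_le => // c' vc' _.
  case: hasP => [[n hn ne]|_]; last first.
    by apply: addr_ge0; apply: sumr_ge0 => // u _; apply: sumr_ge0.
  have n0 : (0 < n)%N by move: hn; rewrite mem_index_iota => /andP[h _]; exact: leq_trans h.
  have NN : N \in index_iota N M.+1 by rewrite mem_index_iota; lia.
  have center_big k : k \in index_iota N M.+1 -> (L < ctr k c')%N ->
      1 <= \sum_(L.+1 <= v < M.+1) (big v c')%:R :> R.
    rewrite mem_index_iota ltnS => /andP[Nk kM] Lk.
    have hk := hctr k c' (leq_trans N1 Nk) vc'; have [/andP[_ ck] _] := hk.
    rewrite (bigD1_seq (ctr k c')) ?iota_uniq ?mem_index_iota ?Lk ?ltnS ?(leq_trans ck) //=.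
    rewrite ler_wpDr ?sumr_ge0 // /big; case: hasP => // -[].
    exists k; first by rewrite mem_index_iota ck ltnS.
    exact: center_large (leq_trans N6 Nk) hk.
  have rest0 : 0 <=
      \sum_(0 <= u < L) \sum_(0 <= v < L) ((u != v) && crosses u.+1 v.+1 N M c')%:R :> R.
    by rewrite sumr_ge0 // => u _; rewrite sumr_ge0.
  case: (leqP (ctr n c') L) => [xL|/(center_big _ hn) h]; last by rewrite ler_wpDr.
  case: (leqP (ctr N c') L) => [yL|/(center_big _ NN) h]; last by rewrite ler_wpDr.
  rewrite ler_wpDl ?sumr_ge0 //.
  have hx := hctr n c' n0 vc'; have hy := hctr N c' N1 vc'.
  have nNM : (N <= n <= M)%N by move: hn; rewrite mem_index_iota ltnS.
  have := centers_cross nNM hx hy (leq_trans xL LN).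
  case: hx hy => [/andP[x0 _] _] [/andP[y0 _] _].
  move: ne x0 y0 xL yL; case: (ctr n c') (ctr N c') => [//|x] [//|y] ne _ _ xL yL cr.
  rewrite (bigD1_seq y) ?iota_uniq ?mem_index_iota //= (bigD1_seq x) ?iota_uniq ?mem_index_iota //=.
  rewrite eq_sym -(eqSS x) ne cr -addrA ler_wpDr ?addr_ge0 ?sumr_ge0 // => u _.
  by rewrite sumr_ge0.
rewrite ExD //.
rewrite !Ex_sum //.
have h1 : \sum_(L.+1 <= v < M.+1) Ex 1 M (fun c' => (big v c')%:R) c <= e / 2.
  apply: le_trans hL; apply: (le_trans (y := \sum_(L.+1 <= v < M.+1) 128 * (v%:R * v.+1%:R)^-1)).
    apply: ler_sum_nat => v hv.
    rewrite (@Ex_tower _ 1 v M); last by lia.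
    rewrite -[leRHS](@Ex_cst _ 1 v _ c); last by lia.
    apply: Ex_le => // [|c' vc' _]; first by lia.
    by apply: subtree_size_maximal => //; lia.
  by rewrite -mulr_sumr ler_wpM2l // sum_inv_le // (leq_trans LN).
have h2 : \sum_(0 <= u < L)
    Ex 1 M (fun c' => \sum_(0 <= v < L) ((u != v) && crosses u.+1 v.+1 N M c')%:R) c
    <= e / 2.
  apply: (le_trans (y := \sum_(0 <= u < L) \sum_(0 <= v < L) (e / 2 / (L ^ 2).+1%:R))).
    apply: ler_sum_nat => u hu; rewrite Ex_sum //.
    apply: ler_sum_nat => v hv /=; case: (eqVneq u v) => /= [_|uv].
      by rewrite Ex_cst // ltW.
    exact: hN0.
  rewrite !sumr_const_nat !subn0 -mulrnA -[leLHS]mulr_natr.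
  rewrite mulrAC ler_pdivrMr //; apply: ler_wpM2l; first exact: ltW.
  by rewrite ler_nat mulnn leqW.
lra.
Qed.

End CenterStable.

(** * Transfer to the probability space *)

Lemma tree_agree c c' n : agree n c c' -> tree c n = tree c' n.
Proof.
elim: n => // -[//|n] IH ag /=.
rewrite -[add_edge (tree c n.+1) _ _]/(add_edge (tree c n.+1) (c n.+1) n.+2).
by rewrite IH ?ag // => k kn; apply: ag; exact: ltnW.
Qed.

Lemma center_indexP c n : valid c -> 0 < n -> is_center c n (center_index (tree c n) n).
Proof.
move=> vc n0; rewrite /center_index.
set le := rank_le (tree c n) n.
have leE x y : le x y = (btw c n y < btw c n x) ||
    ((btw c n x == btw c n y) && (y <= x)).
  by rewrite /le /rank_le !betweennessE.
have tot : total le by move=> x y; rewrite !leE; lia.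
have tr : transitive le by move=> x y z; rewrite !leE; lia.
have := sort_sorted tot (iota 1 n); have := mem_sort le (iota 1 n).
rewrite /rank_pos -/le; case: (sort le (iota 1 n)) => [|x s] ms ss.
  have : 1 \in iota 1 n by rewrite mem_iota; lia.
  by rewrite -ms.
have xin : x \in iota 1 n by rewrite -ms inE eqxx.
have fx : x \in [seq v <- iota 1 n | (index v (x :: s)).+1 == 1].
  by rewrite mem_filter xin /= eqxx.
have -> : head 0 [seq v <- iota 1 n | (index v (x :: s)).+1 == 1] = x.
  have : all (eq_op^~ x) [seq v <- iota 1 n | (index v (x :: s)).+1 == 1].
    apply/allP => y; rewrite mem_filter /= => /andP[+ _].
    by rewrite (eq_sym x); case: (y == x).
  by move: fx; case: [seq v <- _ | _] => //= y t _ /andP[/eqP].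
split; first by move: xin; rewrite mem_iota; lia.
move=> y hy; have : y \in x :: s by rewrite ms mem_iota; lia.
rewrite inE => /predU1P[->|ys]; first by rewrite eqxx leqnn orbT.
by have /allP/(_ y ys) := order_path_min tr ss; rewrite leE.
Qed.

Section Probability.
Local Open Scope classical_set_scope.
Local Open Scope ring_scope.
Context (R : realType) (d : measure_display) (Omega : measurableType d).
Variables (P : probability Omega R) (C : Omega -> nat -> nat).
Hypothesis validC : forall w, valid (C w).
Hypothesis mC : forall n i, (0 < n)%N -> measurable [set w | C w n = i].
Hypothesis unifC : forall n i, (0 < i <= n)%N -> P [set w | C w n = i] = (n%:R^-1)%:E.
Hypothesis indepC : forall n i b, (0 < n)%N -> valid b ->
  P ([set w | C w n = i] `&` [set w | agree n (C w) b]) =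
  (P [set w | C w n = i] * P [set w | agree n (C w) b])%E.

(** [valid] forces the value at 0, so agreement up to 1 is automatic. *)
Let C0 w b : valid b -> agree 1 (C w) b.
Proof. by move=> vb [|//] _; have := validC w 0%N; have := vb 0%N; lia. Qed.

Lemma adapted_upd (A : Type) n i (f : (nat -> nat) -> A) : (0 < i <= n)%N ->
  adapted n.+1 f -> adapted n (fun c => f (upd c n i)).
Proof.
move=> hi ad c c' vc vc' ag; apply: ad; try exact: upd_valid.
by move=> k; rewrite /upd ltnS leq_eqVlt; case: eqP => //= _; exact: ag.
Qed.

Lemma upd_id c n : upd c n (c n) = c.
Proof. by apply/funext => k; rewrite /upd; case: eqP => [->|]. Qed.

Lemma measurable_adapted n (A : (nat -> nat) -> bool) : (0 < n)%N -> adapted n A ->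
  measurable [set w | A (C w)].
Proof.
elim: n A => // -[|n] IH A _ ad.
  (* An event adapted to time 1 is constant, and [id] is a valid sequence at which to read its
     value. *)
  have [A0|A0] := boolP (A id).
    rewrite (_ : [set w | _] = setT) ?measurableT //; apply/seteqP; split=> // w _ /=.
    by rewrite (ad _ id) //; [move=> k; lia|apply: C0 => k; lia].
  rewrite (_ : [set w | _] = set0) ?measurable0 //; apply/seteqP; split=> // w /=.
  by apply/negP; rewrite (ad _ id) //; [move=> k; lia|apply: C0 => k; lia].
rewrite (_ : [set w | _] = \big[setU/set0]_(i <- index_iota 1 n.+2)
   ([set w | C w n.+1 = i] `&` [set w | A (upd (C w) n.+1 i)])).
  rewrite big_seq; apply: bigsetU_measurable => i; rewrite mem_index_iota => hi.
  apply: measurableI; first exact: mC.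
  by apply: (IH (fun c => A (upd c n.+1 i))) => //; apply: adapted_upd.
rewrite -bigcup_seq; apply/seteqP; split=> w /=.
  move=> Aw; exists (C w n.+1); last by split=> //=; rewrite upd_id.
  by rewrite /= mem_index_iota; have := validC w n.+1; lia.
by move=> [i _ [/= <-]]; rewrite /= upd_id.
Qed.

Let cylinder j n b := [set w | forall k, (j <= k < n)%N -> C w k = b k].

Let cylinder1 n b : valid b -> cylinder 1 n b = [set w | agree n (C w) b].
Proof.
move=> vb; apply/seteqP; split=> w /= h.
  by move=> [|k] hk; [exact: C0|exact: h].
by move=> k hk; apply: h; case/andP: hk.
Qed.

Let measurable_cylinder j n b : (0 < j)%N -> measurable (cylinder j n b).
Proof.
move=> j0; rewrite (_ : cylinder j n b = \bigcap_k [set w | (j <= k < n)%N -> C w k = b k]).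
  apply: bigcapT_measurable => k; case: (boolP (j <= k < n)%N) => h.
    rewrite (_ : [set w | _] = [set w | C w k = b k]); first by apply: mC; lia.
    by apply/seteqP; split=> w /=; [apply|].
  by rewrite (_ : [set w | _] = setT) //; apply/seteqP; split=> w.
by apply/seteqP; split=> w /= h k; [move=> _; exact: h|apply: h].
Qed.

Lemma prob_cylinder n b : (0 < n)%N -> valid b ->
  P (cylinder 1 n b) = (\prod_(1 <= k < n) (k%:R)^-1)%:E.
Proof.
move=> n0 vb; elim: n n0 => // -[|n] IH _.
  rewrite big_geq // (_ : cylinder 1 1 b = setT) ?probability_setT //.
  by apply/seteqP; split=> // w _ k; lia.
have -> : cylinder 1 n.+2 b = [set w | C w n.+1 = b n.+1] `&` [set w | agree n.+1 (C w) b].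
  rewrite -cylinder1 //; apply/seteqP; split=> w /=.
    by move=> h; split=> [|k hk]; apply: h; lia.
  by move=> [h1 h2] k hk; case: (eqVneq k n.+1) => [->//|ne]; apply: h2; lia.
rewrite indepC // -cylinder1 // IH // unifC; last by have := vb n.+1; lia.
by rewrite [in RHS]big_nat_recr //= -EFinM mulrC.
Qed.

(** Independence is given against the complete past only, so the cylinder fixes all later
    attachments. Splitting over the last free attachment moves it into the cylinder, lowers [j], and
    matches one [avg] of [Ex]. *)
Lemma prob_adapted_cylinder j n (A : (nat -> nat) -> bool) b c : (0 < j <= n)%N ->
  adapted j A -> valid b -> valid c ->
  P ([set w | A (C w)] `&` cylinder j n b) =
  (Ex 1 j (fun c' => (A c')%:R) c * \prod_(j <= k < n) (k%:R)^-1)%:E.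
Proof.
elim: j A b => // -[|j] IH A b /andP[_ jn] ad vb vc.
  have AC w : A (C w) = A c by apply: ad => //; exact: C0.
  rewrite Exnn; case: (boolP (A c)) => Ac.
    rewrite mul1r -(prob_cylinder jn vb); congr (P _).
    by apply/seteqP; split=> w /=; rewrite ?AC // => -[].
  rewrite mul0r (_ : _ `&` _ = set0) ?measure0 //.
  by apply/seteqP; split=> // w [/=]; rewrite AC (negbTE Ac).
pose F i := [set w | C w j.+1 = i] `&`
  ([set w | A (upd (C w) j.+1 i)] `&` cylinder j.+2 n b).
have FE i : (0 < i <= j.+1)%N ->
    F i = [set w | A (upd (C w) j.+1 i)] `&` cylinder j.+1 n (upd b j.+1 i).
  move=> hi; apply/seteqP; split=> w /=.
    move=> [h1 [h2 h3]]; split=> // k hk; rewrite /upd; case: eqP => [->//|ne].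
    by apply: h3; lia.
  move=> [h1 h2]; split; first by rewrite /= h2 /upd ?eqxx //; lia.
  by split=> // k hk; rewrite /= h2 /upd ?ifN //; lia.
have mF i : (0 < i <= j.+1)%N -> measurable (F i).
  move=> hi; rewrite /F; apply: measurableI; first exact: mC.
  apply: measurableI; last exact: measurable_cylinder.
  by apply: (@measurable_adapted j.+1 (fun c => A (upd c j.+1 i))) => //; apply: adapted_upd.
have -> : [set w | A (C w)] `&` cylinder j.+2 n b =
    \big[setU/set0]_(i < j.+1) F i.+1.
  rewrite -(bigcup_mkord j.+1 (fun i => F i.+1)); apply/seteqP; split=> w /=.
    move=> [h1 h2]; have hc := validC w j.+1.
    exists (C w j.+1).-1; first by rewrite /=; lia.
    by rewrite prednK; [rewrite /F /= upd_id|lia].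
  by move=> [i _ [/= <-]]; rewrite upd_id => -[].
rewrite (@measure_semi_additive_ord_I _ _ _ P (fun i => F i.+1)); first last.
- by apply: bigsetU_measurable => i _; apply: mF; rewrite /= ltn_ord.
- apply/trivIsetP => i i' _ _ ne; apply/seteqP; split=> // w [[/= e _] [/= e' _]].
  by move: ne; rewrite -eqSS -e -e' eqxx.
- by move=> k hk; apply: mF.
have step (i : 'I_j.+1) : P (F i.+1) =
   (Ex 1 j.+1 (fun c' => (A (upd c' j.+1 i.+1))%:R) c * \prod_(j.+1 <= k < n) (k%:R)^-1)%:E.
  rewrite FE ?ltn_ord //; apply: (IH (fun c => A (upd c j.+1 i.+1))) => //.
  - by lia.
  - by apply: adapted_upd => //; rewrite ltn_ord.
  - by apply: upd_valid; rewrite ?ltn_ord.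
rewrite (eq_bigr _ (fun i _ => step i)).
rewrite sumEFin; congr (_%:E); rewrite -mulr_suml big_ltn; last by lia.
rewrite mulrA; congr (_ * _); rewrite ExS // /avg ExZ // mulrC; congr (_ * _).
rewrite Ex_sum // big_add1 /= big_mkord.
by [].
Qed.

Lemma prob_adapted n (A : (nat -> nat) -> bool) c : (0 < n)%N -> adapted n A -> valid c ->
  P [set w | A (C w)] = (Ex 1 n (fun c' => (A c')%:R) c)%:E.
Proof.
move=> n0 ad vc; have := @prob_adapted_cylinder n n A c c _ ad vc vc.
rewrite big_geq // mulr1 => <-; last by rewrite n0 /=.
by congr (P _); apply/seteqP; split=> w /=; [split=> // k; lia|case].
Qed.

(** * The settling time and its measurability *)

Let ctr n (c : nat -> nat) := center_index (tree c n) n.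

Let ctr_adapted n : adapted n (ctr n).
Proof. by move=> c c' _ _ ag; rewrite /ctr (tree_agree ag). Qed.

Definition settled n := [set w | forall m, (n <= m)%N -> ctr m (C w) = ctr n (C w)].

Let moved N M (c : nat -> nat) := has (fun n => ctr n c != ctr N c) (index_iota N M.+1).

Let moved_adapted N M : (N <= M)%N -> adapted M (moved N M).
Proof.
move=> NM c c' vc vc' ag; apply: eq_in_has => n; rewrite mem_index_iota ltnS => /andP[Nn nM].
by rewrite !(ctr_adapted vc vc' (agree_le _ ag)).
Qed.

Let not_settledE N : ~` settled N = \bigcup_k [set w | moved N (N + k) (C w)].
Proof.
apply/seteqP; split=> w /=.
  move=> /existsNP[m /not_implyP[Nm /eqP ne]]; exists (m - N)%N => //=.
  by apply/hasP; exists m; rewrite // mem_index_iota; lia.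
move=> [k _ /hasP[n]]; rewrite mem_index_iota => /andP[Nn _] /eqP ne h.
by apply: ne; apply: h.
Qed.

Let measurable_moved N k : (0 < N)%N -> measurable [set w | moved N (N + k) (C w)].
Proof.
by move=> N0; apply: (@measurable_adapted (N + k)%N); [lia|apply: moved_adapted; lia].
Qed.

Lemma measurable_settled n : (0 < n)%N -> measurable (settled n).
Proof.
move=> n0; rewrite -[settled n]setCK not_settledE; apply: measurableC.
by apply: bigcupT_measurable => k; exact: measurable_moved.
Qed.

(** [center_stable] bounds the chance of a move before each horizon by the same [e]; continuity from
    below passes to the infinite horizon. *)
Lemma never_settled_null : P (\bigcap_n ~` settled n.+1) = 0%E.
Proof.
apply/eqP; rewrite eq_le measure_ge0 andbT; apply/lee_addgt0Pr => e e0.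
rewrite add0e; pose c0 k := (0 < k)%N : nat.
have v0 : valid c0 by move=> k; rewrite /c0; lia.
have hc n c' (n0 : (0 < n)%N) (v : valid c') := center_indexP v n0.
have [N [N0 hN]] := center_stable (ctr := ctr) hc v0 e0.
have mS : measurable (~` settled N) by apply: measurableC; exact: measurable_settled.
apply: (@le_trans _ _ (P (~` settled N))).
  apply: le_measure; rewrite ?inE //.
    by apply: bigcapT_measurable => n; apply: measurableC; exact: measurable_settled.
  by move=> w /(_ N.-1 I); rewrite prednK.
rewrite not_settledE.
have mono : {homo (fun k => [set w | moved N (N + k) (C w)]) : n m / (n <= m)%N >-> (n <= m)%O}.
  move=> k l kl; apply/subsetPset => w /= /hasP[n hn ne]; apply/hasP; exists n => //.
  by move: hn; rewrite !mem_index_iota; lia.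
have := nondecreasing_cvg_mu (mu := P) (fun k => measurable_moved k N0) _ mono.
move=> /(_ (bigcupT_measurable _ (fun k => measurable_moved k N0))) /cvge_to_le; apply.
apply: nearW => k /=.
rewrite (prob_adapted _ (moved_adapted _) v0) ?lee_fin ?hN //; lia.
Qed.

(** The value 0 stands for never; genuine settling times are positive. *)
Let first_settled w : nat :=
  if pselect (exists n, `[< settled n.+1 w >]) is left ex then (ex_minn ex).+1 else 0%N.

Let first_settledP w :
  (first_settled w = 0%N /\ forall n, ~ settled n.+1 w) \/
  exists n, [/\ first_settled w = n.+1, settled n.+1 w &
    forall m, (m < n)%N -> ~ settled m.+1 w].
Proof.
rewrite /first_settled; case: pselect => [ex|nex]; [right|left]; last first.
  by split=> // n h; apply: nex; exists n; apply/asboolP.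
case: ex_minnP => n /asboolP h hmin; exists n; split=> // m mn /asboolP /hmin.
by rewrite leqNgt mn.
Qed.

Let measurable_first_settled k : measurable [set w | first_settled w = k].
Proof.
case: k => [|k].
  rewrite (_ : [set w | _] = \bigcap_n ~` settled n.+1).
    by apply: bigcapT_measurable => n; apply: measurableC; exact: measurable_settled.
  apply/seteqP; split=> w /=.
    by case: (first_settledP w) => [[_ h] _ n _|[n [-> _ _]]]; first exact: h.
  by case: (first_settledP w) => [[-> _]|[n [_ h _]]] // /(_ n I).
rewrite (_ : [set w | _] = settled k.+1 `&` \bigcap_n [set w | (n < k)%N -> ~ settled n.+1 w]).
  apply: measurableI; first exact: measurable_settled.
  apply: bigcapT_measurable => n; case: (ltnP n k) => nk.
    rewrite (_ : [set w | _] = ~` settled n.+1).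
      by apply: measurableC; exact: measurable_settled.
    by apply/seteqP; split=> w /=; [apply|].
  by rewrite (_ : [set w | _] = setT) //; apply/seteqP; split=> w.
apply/seteqP; split=> w /=.
  case: (first_settledP w) => [[-> _]//|[n [-> h hm]] [<-]].
  by split=> // m _; exact: hm.
move=> [hk hm]; case: (first_settledP w) => [[_ /(_ k)]//|[n [-> h hmin]]].
have [nk|kn|->//] := ltngtP n k; first by case: (hm n I nk).
by case: (hmin k kn).
Qed.

Let measurable_at_first_settled (B : eqType) (g : nat -> nat -> B) x :
  measurable [set w | g (first_settled w) (ctr (first_settled w) (C w)) = x].
Proof.
rewrite (_ : [set w | _] = \bigcup_k ([set w | first_settled w = k] `&`
    [set w | g k (ctr k (C w)) == x])).
  apply: bigcupT_measurable => k; apply: measurableI; first exact: measurable_first_settled.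
  (* Time [k.+1] is used because [k] can be 0. *)
  apply: (@measurable_adapted k.+1 (fun c => g k (ctr k c) == x)) => //.
  by move=> c c' v v' ag; rewrite (ctr_adapted v v' (agree_le (leqnSn k) ag)).
apply/seteqP; split=> w /=; last by move=> [k _ [/= <- /eqP]].
by move=> h; exists (first_settled w) => //; split=> //; apply/eqP.
Qed.

Lemma center_persistent : exists N K : Omega -> \bar int,
    [/\ is_integer_rv N /\ is_integer_rv K,
        P [set w | (N w < +oo)%E] = 1%E,
        P [set w | (K w < +oo)%E] = 1%E
      & forall (w : Omega) (n : nat), (1 <= n)%N ->
          (N w <= (n%:Z)%:E)%E -> ((center_index (tree (C w) n) n)%:Z)%:E = K w].
Proof.
(* Where the center never settles, [N] is infinite, so the identity holds for every outcome; [K]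
   then takes the default [center_index] at 0, which is finite. *)
exists (fun w => if first_settled w is k.+1 then (k.+1%:Z)%:E else +oo%E).
exists (fun w => ((ctr (first_settled w) (C w))%:Z)%:E).
split.
- split=> x; first exact: (measurable_at_first_settled
    (fun k _ => if k is k'.+1 then (k'.+1%:Z)%:E else +oo%E : \bar int)).
  exact: (measurable_at_first_settled (fun _ j => (j%:Z)%:E : \bar int)).
- rewrite (_ : [set w | _] = ~` \bigcap_n ~` settled n.+1).
    rewrite probability_setC ?never_settled_null ?sube0 //.
    by apply: bigcapT_measurable => n; apply: measurableC; exact: measurable_settled.
  apply/seteqP; split=> w /=.
    case: (first_settledP w) => [[-> _]|[n [-> h _]] _ /(_ n I)//].
    by rewrite ltxx.
  case: (first_settledP w) => [[-> h] []|[n [-> _ _]] _]; first by move=> n _; exact: h.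
  exact: ltry.
- rewrite (_ : [set w | _] = setT) ?probability_setT //.
  by apply/seteqP; split=> // w _ /=; rewrite ltry.
move=> w n n1; case: (first_settledP w) => [[-> _]//|[k [-> h _]]].
by rewrite lee_fin => kn; congr ((Posz _)%:E); apply: h.
Qed.

End Probability.

(** * From the random trees to their attachment sequence *)

Local Open Scope classical_set_scope.
Local Open Scope ring_scope.

(** At its birth a vertex has its parent as only neighbour, so the past trees and the past
    attachments determine each other. *)
Lemma tree_inj c c' n : valid c -> valid c' ->
  (forall k, (1 <= k <= n)%N -> tree c k = tree c' k) -> agree n c c'.
Proof.
move=> vc vc' h [|k] kn; first by have := vc 0%N; have := vc' 0%N; lia.
have hk := vc k.+1; have : tree c k.+2 (c k.+1) k.+2 by rewrite treeE // eqxx; lia.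
rewrite h ?treeE //= => /orP[/andP[_ /eqP->]//|/andP[_ /eqP e]].
by have := vc' (c k.+1).-1; lia.
Qed.

Theorem theorem26 (R : realType) (d : measure_display)
    (Omega : measurableType d) (P : probability Omega R)
    (T : nat -> Omega -> rel nat) (hT : is_URRT P T) :
  exists N K : Omega -> \bar int,
    [/\ is_integer_rv N /\ is_integer_rv K,
        P [set w | (N w < +oo)%E] = 1%E,
        P [set w | (K w < +oo)%E] = 1%E
      & forall (w : Omega) (n : nat), (1 <= n)%N ->
          (N w <= (n%:Z)%:E)%E -> ((center_index (T n w) n)%:Z)%:E = K w].
Proof.
case: hT => T1 [c hc].
(* Index 0 receives the dummy value that [valid] requires. *)
pose C w k := if k is 0 then 0%N else c k w.
have vC w : valid (C w).
  by case=> [|k] //; have [/(_ w)] := hc k.+1 isT.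
have TC n w : (0 < n)%N -> T n w = tree (C w) n.
  elim: n => // -[|n] IH _; first by rewrite T1.
  by have [_ _ -> _ _] := hc n.+1 isT; rewrite IH.
have mC n i : (0 < n)%N -> measurable [set w | C w n = i].
  by case: n => // n _; have [_ + _ _ _] := hc n.+1 isT; apply.
have uC n i : (0 < i <= n)%N -> P [set w | C w n = i] = (n%:R^-1)%:E.
  by case: n => [|n] hi; [lia|have [_ _ _ + _] := hc n.+1 isT; apply].
have iC n i b : (0 < n)%N -> valid b ->
    P ([set w | C w n = i] `&` [set w | agree n (C w) b]) =
    (P [set w | C w n = i] * P [set w | agree n (C w) b])%E.
  case: n => // n _ vb; have [_ _ _ _ /(_ i (tree b)) /=] := hc n.+1 isT.
  (* The product rule is taken at the past given by the trees of [b], which is the event that the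
     attachments agree with [b]. *)
  rewrite (_ : [set w | forall k, _ -> T k w = tree b k] = [set w | agree n.+1 (C w) b]) //.
  apply/seteqP; split=> w /= h.
    by apply: tree_inj => // k hk; rewrite -TC ?h //; lia.
  by move=> k hk; rewrite TC; [apply: tree_agree; apply: agree_le h; lia|lia].
have [N [K [rv PN PK h]]] := center_persistent vC mC uC iC.
by exists N, K; split=> // w n n1 Nn; rewrite TC //; exact: h.
Qed.
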